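(* For every integer $n\geq 1$, let $K_n$ be the knot given as the closure of the $4$-braid $$\beta_n=(\sigma_2\sigma_1\sigma_3\sigma_2)^{2n+1}\,\sigma_1^{-1}\sigma_2\sigma_1\sigma_1\sigma_2 .$$ Then the Khovanov homology of $K_n$ satisfies $$Kh^{i,j}(K_n)\cong\begin{cases}\mathbb{Z} & \text{if } (i,j)=(0,4+8n\pm1),\\ 0 & \text{for all other } (i,j) \text{ with } i\leq1.\end{cases}$$
   Context: $\sigma_1,\sigma_2,\sigma_3$ are the standard Artin generators of the braid group on $4$ strands, with the convention that each $\sigma_i$ is a positive crossing in the braid closure (with all strands oriented in parallel). $Kh^{i,j}$ denotes Khovanov homology with integer coefficients, $i$ the homological and $j$ the quantum grading, in Bar-Natan's conventions: $Kh$ of the unknot is $\mathbb{Z}$ in gradings $(0,\pm1)$, and the positive trefoil has homology in homological gradings $\ge 0$ with $Kh^{0,1}=Kh^{0,3}=\mathbb{Z}$. *)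

(* Defs.v *)
From HB Require Import structures.
From mathcomp Require Import all_boot all_order all_algebra.
From mathcomp Require Import boolp.

Set Implicit Arguments.
Unset Strict Implicit.
Unset Printing Implicit Defensive.

Import GRing.Theory.
Local Open Scope ring_scope.

(** ** Homology of a pair of composable additive maps *)

Section Homology.
Variables (A B C : zmodType) (f : {additive A -> B}) (g : {additive B -> C}).

Definition cycle_pred : pred B := fun x => g x == 0.

Fact cycle_pred_closed : zmod_closed cycle_pred.
Proof.
split=> [|x y]; rewrite /cycle_pred !unfold_in ?raddf0 //.
by move=> /eqP gx /eqP gy; rewrite raddfB gx gy subrr.
Qed.
HB.instance Definition _ := GRing.isZmodClosed.Build B cycle_pred cycle_pred_closed.

Record cycles := Cycle { cycle_val :> B; _ : cycle_val \in cycle_pred }.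
HB.instance Definition _ := [isSub for cycle_val].
HB.instance Definition _ := [Choice of cycles by <:].
HB.instance Definition _ := [SubChoice_isSubZmodule of cycles by <:].

Definition boundary_pred : pred cycles := fun z => `[< exists a : A, f a = val z >].

Fact boundary_pred_closed : zmod_closed boundary_pred.
Proof.
split=> [|x y]; rewrite /boundary_pred !unfold_in.
  by apply/asboolP; exists 0; rewrite !raddf0.
by move=> /asboolP[a fa] /asboolP[b fb]; apply/asboolP; exists (a - b);
   rewrite !raddfB fa fb.
Qed.
HB.instance Definition _ :=
  GRing.isZmodClosed.Build cycles boundary_pred boundary_pred_closed.

Definition homology : zmodType :=
  Quotient.quot (GRing.ZmodClosed.clone _ boundary_pred _).

End Homology.

Definition zmod_iso (A B : zmodType) : Prop :=
  exists h : {additive A -> B}, bijective h.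

(** ** Oriented link diagrams

    A planar diagram code.  The crossing [k] is recorded as the quadruple
    (x1, x2, x3, x4) of the edges around it, listed counterclockwise starting
    from the incoming lower edge.  [link_join e f] says that the ends of [e] and
    [f] are glued to each other away from the crossings, so that edges may be
    subdivided and crossingless components are allowed. *)

Record link_diagram := LinkDiagram {
  link_edge : finType;
  link_join : rel link_edge;
  link_ncross : nat;
  link_cross : 'I_link_ncross ->
    link_edge * link_edge * link_edge * link_edge;
  link_positive : 'I_link_ncross -> bool
}.

Section Khovanov.
Variable D : link_diagram.
Local Notation edge := (link_edge D).
Local Notation crossing := 'I_(link_ncross D).

Definition n_plus : nat := #|[pred k : crossing | link_positive k]|.
Definition n_minus : nat := #|[pred k : crossing | ~~ link_positive k]|.

Definition state := {ffun crossing -> bool}.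

(** The 0-smoothing of (x1, x2, x3, x4) joins x1 to x2 and x3 to x4, the
    1-smoothing joins x1 to x4 and x2 to x3. *)
Definition smoothing (b : bool) (k : crossing) (e f : edge) : bool :=
  let: (x1, x2, x3, x4) := link_cross k in
  if b then ((e, f) == (x1, x4)) || ((e, f) == (x2, x3))
  else ((e, f) == (x1, x2)) || ((e, f) == (x3, x4)).

Definition adjacent (s : state) (e f : edge) : bool :=
  let r e f := link_join e f || [exists k, smoothing (s k) k e f] in
  r e f || r f e.

(** [e] and [f] lie on the same circle of the complete smoothing [s]. *)
Definition same_circle (s : state) : rel edge := connect (adjacent s).

Definition circles (s : state) : {set {set edge}} :=
  equivalence_partition (same_circle s) [set: edge].

(** A basis vector of the cube of resolutions is a state together with a label
    on each of its circles, [true] for v_+ and [false] for v_-.  The labels are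
    encoded as a function on edges which is constant on every circle. *)
Definition labelled_state := (state * {ffun edge -> bool})%type.

Definition valid (S : labelled_state) : bool :=
  [forall e, forall f, same_circle S.1 e f ==> (S.2 e == S.2 f)].

Definition weight (s : state) : nat := #|[pred k | s k]|.

Definition hdeg (S : labelled_state) : int := (weight S.1)%:Z - n_minus%:Z.

Definition circle_plus (S : labelled_state) (c : {set edge}) : bool :=
  [exists e in c, S.2 e].

Definition qdeg (S : labelled_state) : int :=
  \sum_(c in circles S.1) (if circle_plus S c then 1 else -1)
  + (weight S.1)%:Z + n_plus%:Z - n_minus%:Z *+ 2.

(** Matrix coefficients of the multiplication
      v_+ (x) v_+ |-> v_+,  v_+ (x) v_-, v_- (x) v_+ |-> v_-,  v_- (x) v_- |-> 0
    and of the comultiplication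
      v_+ |-> v_+ (x) v_- + v_- (x) v_+,  v_- |-> v_- (x) v_-. *)
Definition mult_coef (a b c : bool) : bool := (a || b) && (c == a && b).
Definition comult_coef (a b c : bool) : bool :=
  if a then b (+) c else ~~ b && ~~ c.

(** Coefficient of [S'] in the image of [S] under the cube edge map which
    changes the smoothing of the crossing [k] from 0 to 1.  In both smoothings
    each circle through the crossing contains x1 or x3.  For a planar diagram
    the edge map always merges or splits circles, that is, x1 and x3 lie
    on the same circle in exactly one of the two smoothings. *)
Definition edge_coef (k : crossing) (S S' : labelled_state) : bool :=
  let: (x1, _, x3, _) := link_cross k in
  let: (s, l) := S in
  let: (s', l') := S' in
  [&& ~~ s k,
      s' == [ffun m => (m == k) || s m],
      [forall e, [|| same_circle s x1 e, same_circle s x3 e | l' e == l e]] &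
      if ~~ same_circle s x1 x3 then mult_coef (l x1) (l x3) (l' x1)
      else ~~ same_circle s' x1 x3 && comult_coef (l x1) (l' x1) (l' x3)].

Definition edge_sign (k : crossing) (s : state) : int :=
  (-1) ^+ #|[pred m : crossing | (m < k)%N && s m]|.

Definition diff_coef (S S' : labelled_state) : int :=
  \sum_(k | edge_coef k S S') edge_sign k S.1.

Definition basis (i j : int) :=
  {S : labelled_state | [&& valid S, hdeg S == i & qdeg S == j]}.

Definition chain (i j : int) : zmodType := {ffun basis i j -> int}.

(** The component C^{i,j} -> C^{i',j} of the differential; it vanishes unless
    i' = i + 1. *)
Definition diff (i i' j : int) (x : chain i j) : chain i' j :=
  [ffun S' => \sum_S diff_coef (val S) (val S') * x S].

Fact diff_is_zmod_morphism (i i' j : int) : zmod_morphism (@diff i i' j).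
Proof.
move=> x y; apply/ffunP=> S'; rewrite !ffunE -sumrB.
by apply: eq_bigr => S _; rewrite !ffunE mulrBr.
Qed.
HB.instance Definition _ (i i' j : int) :=
  GRing.isZmodMorphism.Build (chain i j) (chain i' j) (@diff i i' j)
    (@diff_is_zmod_morphism i i' j).

(** Khovanov homology in homological degree [i] and quantum degree [j]. *)
Definition Kh (i j : int) : zmodType :=
  homology (@diff (i - 1) i j) (@diff i (i + 1) j).

End Khovanov.

(** ** Braid words and their closures *)

(** The letter [(k, true)] of a word on [m.+1] strands is the generator
    sigma_{k+1}, crossing the strands in positions [k] and [k.+1] (counted from
    0), and [(k, false)] is its inverse. *)
Definition braid_word (m : nat) := seq ('I_m * bool).

Definition braid_exp m (n : nat) (w : braid_word m) : braid_word m :=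
  flatten (nseq n w).

Section BraidClosure.
Variables (m : nat) (w : braid_word m).
Local Notation letter := (tnth (in_tuple w)).

(** The edge [(t, p)] is the piece of strand in position [p] just below the
    [t]-th crossing; strands are oriented upwards. *)
Definition closure_edge := ('I_(size w).+1 * 'I_m.+1)%type.

Definition closure_join (e f : closure_edge) : bool :=
  (e.2 == f.2) &&
  (((e.1 == ord_max) && (f.1 == ord0)) ||
   [exists t : 'I_(size w),
      [&& e.1 == t :> nat, f.1 == t.+1 :> nat,
          e.2 != (letter t).1 :> nat & e.2 != (letter t).1.+1 :> nat]]).

(** In a positive crossing the strand going from bottom left to top right is
    the upper one, in a negative crossing it is the lower one. *)
Definition closure_cross (t : 'I_(size w)) :
    closure_edge * closure_edge * closure_edge * closure_edge :=
  let k := (letter t).1 in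
  let bot := widen_ord (leqnSn (size w)) t in
  let top := lift ord0 t in
  let left := widen_ord (leqnSn m) k in
  let right := lift ord0 k in
  if (letter t).2
  then ((bot, right), (top, right), (top, left), (bot, left))
  else ((bot, left), (bot, right), (top, right), (top, left)).

Definition braid_closure : link_diagram :=
  @LinkDiagram closure_edge closure_join (size w) closure_cross
    (fun t => (letter t).2).

End BraidClosure.

Definition sigma1 : 'I_3 * bool := (@Ordinal 3 0 isT, true).
Definition sigma2 : 'I_3 * bool := (@Ordinal 3 1 isT, true).
Definition sigma3 : 'I_3 * bool := (@Ordinal 3 2 isT, true).
Definition sigma1_inv : 'I_3 * bool := (@Ordinal 3 0 isT, false).

Definition beta (n : nat) : braid_word 3 :=
  braid_exp (2 * n + 1) [:: sigma2; sigma1; sigma3; sigma2]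
  ++ [:: sigma1_inv; sigma2; sigma1; sigma1; sigma2].

Definition K (n : nat) : link_diagram := braid_closure (beta n).

(* Main.v *)
(** The word [beta n] has a single negative letter.  Resolving that crossing
    splits the cube of resolutions into the cube of the closure with a cap and
    a cup in its place, and the cube of the closure of a positive braid.

    The first one is exact in weights 0, 1 and 2: next to the cap, a letter
    acting on the same two strands is a kink, whose edge map has a retraction
    commuting with the rest of the cube and so shifts the homology up by one;
    letters in between are removed by filtering the cube.  In the second one, a
    letter whose generator occurs elsewhere in the word splits a circle once it
    is smoothed, hence can be removed without changing the homology in degrees
    0 and 1, until one letter of each kind is left; that leaves explicit linear
    algebra on the labels of the four strands.

    The labels of a state span a cyclic module over the multiplications [X_e] by
    [v_-] on the circle of [e].  A merge sends the generator to the generator, a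
    split sends it to its image by [X_a + X_b], and this reduces the commutativity
    of the faces of the cube to counting circles. *)

From HB Require Import structures.
Require Import Defs.
From mathcomp Require Import all_boot all_order all_algebra.
From mathcomp Require Import fingroup perm boolp zify ring.

Set Implicit Arguments.
Unset Strict Implicit.
Unset Printing Implicit Defensive.

Import GRing.Theory.
Local Open Scope ring_scope.

(** * Circles of a state *)

(** Of the prefix before the last block only positivity and length are used: the nine final letters
    suffice for every exactness statement, and the length merely shifts the quantum degree. Since
    there is one negative letter, homological degree [i] is weight [i + 1], so only weights 0, 1 and
    2 matter. What survives in degree 0 is the common kernel of the merges of neighbouring factors
    of V^{(x) 4}, where V = Z[X]/(X^2) with v_+ = 1 and v_- = X. This kernel has rank two, with
    generators two quantum degrees apart, whence the offsets +1 and -1 of the theorem. Exactness is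
    proved for integer functions on all labels at once and cut down to a quantum degree only at the
    end, so the arguments on the cube need not track the grading. Planarity enters as a count of
    circles that changes by one along each edge of the cube; for braid closures the count is the
    number of cycles of a permutation. *)

Section Cube.
Variable D : link_diagram.
Local Notation edge := (link_edge D).
Local Notation crossing := 'I_(link_ncross D).
Local Notation label := {ffun edge -> bool}.
Implicit Types (s t : state D) (k m a : crossing) (e f : edge) (l : label).

Definition arc1 k : edge := (link_cross k).1.1.1.
Definition arc3 k : edge := (link_cross k).1.2.

Definition on s k : state D := [ffun m => (m == k) || s m].
Definition off s k : state D := [ffun m => (m != k) && s m].

Lemma on_id s k : on s k k. Proof. by rewrite ffunE eqxx. Qed.
Lemma off_id s k : off s k k = false. Proof. by rewrite ffunE eqxx. Qed.
Lemma on_neq s k m : m != k -> on s k m = s m.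
Proof. by rewrite ffunE => /negPf ->. Qed.
Lemma off_neq s k m : m != k -> off s k m = s m.
Proof. by rewrite ffunE => ->. Qed.
Lemma onK s k : s k = false -> off (on s k) k = s.
Proof. by move=> sk; apply/ffunP=> m; rewrite !ffunE; case: eqP => // ->. Qed.
Lemma offK s k : s k -> on (off s k) k = s.
Proof. by move=> sk; apply/ffunP=> m; rewrite !ffunE; case: eqP => // ->. Qed.
Lemma onC s k m : on (on s k) m = on (on s m) k.
Proof. by apply/ffunP=> n; rewrite !ffunE orbCA. Qed.
Lemma offC s k m : off (off s k) m = off (off s m) k.
Proof. by apply/ffunP=> n; rewrite !ffunE andbCA. Qed.
Lemma on_off s k m : k != m -> on (off s k) m = off (on s m) k.
Proof.
move=> km; apply/ffunP=> n; rewrite !ffunE.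
by case: (n =P m) => // ->; rewrite eq_sym km.
Qed.

Lemma adjacent_sym s : symmetric (adjacent s).
Proof. by move=> e f; rewrite /adjacent orbC. Qed.
Lemma same_sym s : symmetric (same_circle s).
Proof. exact: sym_connect_sym (@adjacent_sym s). Qed.
Lemma same_refl s e : same_circle s e e. Proof. exact: connect0. Qed.
Lemma same_trans s : transitive (same_circle s). Proof. exact: connect_trans. Qed.
Lemma same_eqr s e f g : same_circle s e f -> same_circle s e g = same_circle s f g.
Proof. by move=> h; exact: (same_connect (@same_sym s) h). Qed.
Hint Resolve same_refl : core.

Lemma same_sub s (R : rel edge) :
  (forall e f, adjacent s e f -> R e f) -> reflexive R -> transitive R ->
  forall e f, same_circle s e f -> R e f.
Proof.
move=> sR Rr Rt e f /connectP[p]; elim: p e => [|g p IH] e /=.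
  by move=> _ ->.
by case/andP=> eg pth fE; apply: Rt (sR _ _ eg) _; exact: IH.
Qed.

(** The circles through the crossing [k] are those of [arc1 k] and [arc3 k]. *)
Definition near s k e := same_circle s (arc1 k) e || same_circle s (arc3 k) e.

Lemma adjacent_smoothing s k e f : smoothing (s k) k e f -> adjacent s e f.
Proof.
move=> h; rewrite /adjacent.
by apply/orP; left; apply/orP; right; apply/existsP; exists k.
Qed.

(** Neither smoothing joins x1 to x3, so whichever one [s] uses, each of x2 and x4 is joined to x1
    or x3. The smoothing [b] need not be that of [s], which allows comparing two states at [k]. *)
Lemma near_smoothing s b k e f : smoothing b k e f -> near s k e && near s k f.
Proof.
have H e' f' : smoothing (s k) k e' f' -> same_circle s e' f'.
  by move=> h; apply/connect1/adjacent_smoothing/h.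
move: H; rewrite /near /arc1 /arc3 /smoothing.
case: (link_cross k) => [[[x1 x2] x3] x4] /=.
case: (s k) => H.
- have h14 : same_circle s x1 x4 by apply: H; rewrite eqxx.
  have h32 : same_circle s x3 x2 by rewrite same_sym; apply: H; rewrite eqxx orbT.
  by case: b => /orP[] /eqP[-> ->]; rewrite ?same_refl ?h14 ?h32 ?orbT.
- have h12 : same_circle s x1 x2 by apply: H; rewrite eqxx.
  have h34 : same_circle s x3 x4 by apply: H; rewrite eqxx orbT.
  by case: b => /orP[] /eqP[-> ->]; rewrite ?same_refl ?h12 ?h34 ?orbT.
Qed.

Lemma adjacent_change s t k e f : (forall m, m != k -> s m = t m) ->
  adjacent s e f -> adjacent t e f || (near s k e && near s k f && near t k e && near t k f).
Proof.
move=> st; rewrite /adjacent.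
have H e' f' : link_join e' f' || [exists m, smoothing (s m) m e' f'] ->
  adjacent t e' f' || [&& near s k e', near s k f', near t k e' & near t k f'].
  case/orP=> [h|/existsP[m h]]; first by rewrite /adjacent h.
  have [mk|mk] := eqVneq m k.
    by move: h; rewrite mk => h; case/andP: (near_smoothing s h) => -> ->;
       case/andP: (near_smoothing t h) => -> ->; rewrite orbT.
  by apply/orP; left; apply: (@adjacent_smoothing _ m); rewrite -st.
case/orP=> /H.
  by rewrite /adjacent; case/orP=> [->//|/and4P[-> -> -> ->]]; rewrite orbT.
by rewrite adjacent_sym; rewrite {1}/adjacent; case/orP=> [->//|/and4P[-> -> -> ->]]; rewrite orbT.
Qed.

(** It is left open which of [s] and [t] has [k] smoothed to 1, so that a split is a merge read
    backwards. *)
Lemma same_merge s t k : (forall m, m != k -> s m = t m) ->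
  ~~ same_circle s (arc1 k) (arc3 k) -> same_circle t (arc1 k) (arc3 k) ->
  forall e f, same_circle t e f = same_circle s e f || (near s k e && near s k f).
Proof.
move=> st ns nt e f.
have nearE g : near t k g = same_circle t (arc1 k) g.
  by rewrite /near -(same_eqr _ nt) orbb.
apply/idP/idP.
  pose R e f := same_circle s e f || (near s k e && near s k f).
  apply: (@same_sub t R); rewrite {}/R => {e f}.
  - move=> e f /(adjacent_change (k := k) (fun m h => esym (st m h))).
    case/orP=> [h|]; first by rewrite /same_circle connect1.
    by case/andP=> [/andP[_ ->] ->]; rewrite orbT.
  - by move=> e; rewrite same_refl.
  - have near_same e f : same_circle s e f -> near s k e = near s k f.
      by move=> h; rewrite /near 2!(same_sym s _ e) !(same_eqr _ h) !(same_sym s f).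
    move=> f e g /orP[ef|/andP[ne nf]] /orP[fg|/andP[nf' ng]].
    + by rewrite (same_trans ef fg).
    + by rewrite (near_same _ _ ef) nf' ng orbT.
    + by rewrite ne -(near_same _ _ fg) nf orbT.
    + by rewrite ne ng orbT.
have sub : forall e f, same_circle s e f -> same_circle t e f.
  apply: (@same_sub s (same_circle t)).
  - move=> {}e {}f /(adjacent_change (k := k) st).
    case/orP=> [h|]; first exact: connect1.
    rewrite !nearE => /andP[/andP[_ he] hf].
    by apply: same_trans hf; rewrite same_sym.
  - exact: same_refl.
  - exact: same_trans.
case/orP=> [/sub //|/andP[ne nf]].
have near1 g : near s k g -> same_circle t (arc1 k) g.
  by case/orP=> /sub // h; apply: same_trans nt h.
by apply: (@same_trans _ (arc1 k)); [rewrite same_sym|]; exact: near1.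
Qed.


Definition splits s k := same_circle s (arc1 k) (arc3 k).

(** What is used of planarity; [c s] stands for the number of circles of [s]. *)
Definition planar := exists c : state D -> int, forall s k, s k = false ->
  splits (on s k) k = ~~ splits s k /\
  c (on s k) = c s + (if splits s k then 1 else -1).

Hypothesis Dpl : planar.

Lemma splits_on s k : s k = false -> splits (on s k) k = ~~ splits s k.
Proof. by case: Dpl => c cP /cP[]. Qed.

Lemma same_on_merge s k : s k = false -> ~~ splits s k ->
  forall e f, same_circle (on s k) e f = same_circle s e f || (near s k e && near s k f).
Proof.
move=> sk nsp; apply: (same_merge _ nsp); first by move=> m mk; rewrite on_neq.
by have := splits_on sk; rewrite nsp.
Qed.

Lemma same_on_split s k : s k = false -> splits s k ->
  forall e f, same_circle s e f =
    same_circle (on s k) e f || (near (on s k) k e && near (on s k) k f).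
Proof.
move=> sk sp; apply: (same_merge _ _ sp); first by move=> m mk; rewrite on_neq.
by rewrite -/(splits _ _) splits_on // sp.
Qed.

Lemma validP s l :
  reflect (forall e f, same_circle s e f -> l e = l f) (valid (s, l)).
Proof.
apply: (iffP forallP) => [h e f ef|h e].
  by move/forallP: (h e) => /(_ f); rewrite ef => /eqP.
by apply/forallP=> f; apply/implyP=> /h ->.
Qed.

Definition raise s e l : label := [ffun f => same_circle s e f || l f].

Lemma valid_raise s t e l : (forall f g, same_circle s f g -> same_circle t f g) ->
  valid (s, l) -> valid (s, raise t e l).
Proof.
move=> st /validP h; apply/validP=> f g fg; rewrite !ffunE (h _ _ fg).
by rewrite 2!(same_sym t e) (same_eqr _ (st _ _ fg)).
Qed.

Lemma raiseC s e f l : raise s e (raise s f l) = raise s f (raise s e l).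
Proof. by apply/ffunP=> g; rewrite !ffunE orbCA. Qed.

Lemma raise_same s e f : same_circle s e f -> raise s e =1 raise s f.
Proof. by move=> ef l; apply/ffunP=> g; rewrite !ffunE (same_eqr _ ef). Qed.

(** Only the values of [x] at labels which are valid for [s] matter. *)
Definition edge_map k s (x : label -> int) : label -> int := fun l' =>
  \sum_(l | valid (s, l) && edge_coef k (s, l) (on s k, l')) x l.

Lemma edge_coefE s k l l' : s k = false ->
  edge_coef k (s, l) (on s k, l') =
  [forall e, near s k e || (l' e == l e)] &&
  (if splits s k then comult_coef (l (arc1 k)) (l' (arc1 k)) (l' (arc3 k))
   else mult_coef (l (arc1 k)) (l (arc3 k)) (l' (arc1 k))).
Proof.
move=> sk; have := splits_on sk; rewrite /edge_coef /splits /near /arc1 /arc3.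
case: (link_cross k) => [[[x1 x2] x3] x4] /= ->; rewrite sk eqxx /=.
congr (_ && _); last by case: (same_circle s x1 x3).
by apply: eq_forallb => e; rewrite orbA.
Qed.

Lemma edge_map_ext k s (x y : label -> int) l' :
  (forall l, valid (s, l) -> x l = y l) -> edge_map k s x l' = edge_map k s y l'.
Proof. by move=> xy; apply: eq_bigr => l /andP[/xy]. Qed.

Lemma edge_map_lin k s (x y : label -> int) (a b : int) l' :
  edge_map k s (fun l => a * x l + b * y l) l' =
  a * edge_map k s x l' + b * edge_map k s y l'.
Proof. by rewrite /edge_map big_split /= !big_distrr. Qed.

(** A chain is its function of coefficients, so the map is read at the target label: v_+ on the
    merged circle comes from v_+ (x) v_+ only, v_- from the two labels with one v_+ and one v_-. *)
Lemma edge_map_merge s k (x : label -> int) l' :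
  s k = false -> ~~ splits s k -> valid (on s k, l') ->
  edge_map k s x l' =
  if l' (arc1 k) then x l' else x (raise s (arc1 k) l') + x (raise s (arc3 k) l').
Proof.
set a := arc1 k; set b := arc3 k => sk nsp /validP vl'.
have nab : same_circle s a b = false by apply: negbTE.
have sub e f : same_circle s e f -> same_circle (on s k) e f.
  by rewrite same_on_merge // => ->.
have vsl' : valid (s, l') by apply/validP=> e f /sub /vl'.
have ab : l' a = l' b by apply: vl'; rewrite -/(splits (on s k) k) splits_on.
have nearl e : near s k e -> l' e = l' a.
  by case/orP=> /sub/vl' <-.
have off_near (l : label) e : near s k e || (l' e == l e) -> near s k e = false -> l e = l' e.
  by move=> + ne; rewrite ne => /eqP.
rewrite /edge_map; case: ifP => l'a.
  rewrite (big_pred1 l') // => l; rewrite edge_coefE // (negPf nsp) -/a -/b l'a /mult_coef.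
  apply/idP/eqP=> [/andP[/validP vl /andP[/forallP h hm]]|->].
    have /andP[la lb] : l a && l b by move: hm; case: (l a); case: (l b).
    apply/ffunP=> e; case: (boolP (near s k e)) => [ne|/negbTE ne].
      rewrite (nearl _ ne) l'a; case/orP: ne => /vl <- //.
    exact: off_near.
  rewrite vsl' -ab l'a /= andbT; apply/forallP=> e; by rewrite eqxx orbT.
have l'b : l' b = false by rewrite -ab.
have neq : raise s a l' != raise s b l'.
  apply/eqP=> /ffunP/(_ a); rewrite !ffunE same_refl l'a.
  by rewrite same_sym nab.
rewrite (bigD1 (raise s a l')) /=; last first.
  rewrite valid_raise // edge_coefE // (negPf nsp) -/a -/b /mult_coef !ffunE.
  rewrite same_refl nab l'a l'b /= andbT; apply/forallP=> e.
  by rewrite ffunE /near -/a; case: (same_circle s a e) => //=; rewrite eqxx orbT.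
congr (_ + _); rewrite (big_pred1 (raise s b l')) // => l.
rewrite edge_coefE // (negPf nsp) -/a -/b l'a /mult_coef.
apply/idP/eqP=> [/andP[/andP[/validP vl /andP[/forallP h hm]] nl]|->].
  have h2 e : near s k e = false -> l e = l' e by apply: off_near.
  case la: (l a) hm; case lb: (l b) => //= _.
    case/eqP: nl; apply/ffunP=> e; rewrite ffunE.
    case: (boolP (same_circle s a e)) => [/vl <- //|nae] /=.
    case: (boolP (same_circle s b e)) => [be|nbe].
      by rewrite -(vl _ _ be) lb nearl // /near be orbT.
    by apply: h2; rewrite /near (negPf nae) (negPf nbe).
  apply/ffunP=> e; rewrite ffunE.
  case: (boolP (same_circle s b e)) => [/vl <- //|nbe] /=.
  case: (boolP (same_circle s a e)) => [ae|nae].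
    by rewrite -(vl _ _ ae) la nearl // /near ae.
  by apply: h2; rewrite /near (negPf nae) (negPf nbe).
rewrite valid_raise // [raise s b l' == _]eq_sym neq !ffunE same_refl (same_sym _ b) nab l'a l'b /= !andbT.
apply/forallP=> e; rewrite ffunE /near -/b.
by case: (same_circle s b e) => /=; rewrite ?orbT // eqxx orbT.
Qed.

Lemma edge_map_split s k (x : label -> int) l' :
  s k = false -> splits s k -> valid (on s k, l') ->
  edge_map k s x l' =
  if l' (arc1 k) && l' (arc3 k) then 0
  else if l' (arc1 k) || l' (arc3 k) then x (raise s (arc1 k) l') else x l'.
Proof.
set a := arc1 k; set b := arc3 k => sk sp /validP vl'.
have sE := same_on_split sk sp.
have sub e f : same_circle (on s k) e f -> same_circle s e f.
  by move=> h; rewrite sE h.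
have nearE e : near s k e = same_circle s a e.
  by rewrite /near -/a -/b -(same_eqr e sp) orbb.
have vr : valid (s, raise s a l').
  apply/validP=> e f ef; rewrite !ffunE; move: (ef); rewrite sE.
  case/orP=> [h|/andP[ne nf]].
    by rewrite (vl' _ _ h) 2!(same_sym s a) (same_eqr _ ef).
  have nr g : near (on s k) k g -> same_circle s a g.
    by case/orP=> /sub // h; rewrite (same_eqr g sp).
  by rewrite (nr _ ne) (nr _ nf).
have near' e : same_circle s a e -> l' e = l' a \/ l' e = l' b.
  rewrite sE => /orP[/vl' <-|/andP[_ /orP[]/vl' <-]]; by [left | right].
have uniq (l : label) c : valid (s, l) -> l a = c ->
    [forall e, near s k e || (l' e == l e)] ->
    l = [ffun e => if same_circle s a e then c else l' e].
  move=> /validP vl lac /forallP h; apply/ffunP=> e; rewrite ffunE.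
  case: ifP => [/vl <- //|nae].
  by move: (h e); rewrite nearE nae => /eqP.
rewrite /edge_map; case: ifP => [/andP[l'a l'b]|].
  rewrite big_pred0 // => l; rewrite edge_coefE // sp -/a -/b l'a l'b /comult_coef.
  by case: (l a); rewrite /= !andbF.
move=> nl'; case: ifP => [ol'|nol'].
  rewrite (big_pred1 (raise s a l')) // => l.
  rewrite edge_coefE // sp -/a -/b /comult_coef.
  apply/idP/eqP=> [/andP[vl /andP[h hm]]|->].
    have la : l a by move: hm; case: (l a) => //; case: (l' a) ol' nl'; case: (l' b).
    rewrite (uniq _ _ vl la h); apply/ffunP=> e; rewrite !ffunE.
    by case: (same_circle s a e).
  rewrite vr ffunE same_refl /=; apply/andP; split.
    apply/forallP=> e; rewrite nearE ffunE.
    by case: (same_circle s a e) => //=.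
  by case: (l' a) ol' nl'; case: (l' b).
rewrite (big_pred1 l') // => l.
have [l'a l'b] : l' a = false /\ l' b = false by case: (l' a) (l' b) nol' => [] [].
have l'E : l' = [ffun e => if same_circle s a e then false else l' e].
  apply/ffunP=> e; rewrite ffunE; case: ifP => // /near' [] ->; by rewrite ?l'a ?l'b.
rewrite edge_coefE // sp -/a -/b l'a l'b /comult_coef.
apply/idP/eqP=> [/andP[vl /andP[h hm]]|->].
  have la : l a = false by move: hm; case: (l a).
  by rewrite (uniq _ _ vl la h).
rewrite l'a /= andbT; apply/andP; split; last first.
  by apply/forallP=> e; rewrite eqxx orbT.
apply/validP=> e f; rewrite sE => /orP[/vl' //|/andP[ne nf]].
have nr g : near (on s k) k g -> l' g = false by case/orP=> /vl' <-.
by rewrite (nr _ ne) (nr _ nf).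
Qed.

End Cube.

(** * Edge maps and the faces of the cube *)

Section Faces.
Variable D : link_diagram.
Local Notation edge := (link_edge D).
Local Notation crossing := 'I_(link_ncross D).
Local Notation label := {ffun edge -> bool}.
Implicit Types (s t : state D) (k m a : crossing) (e f : edge) (l : label).
Hypothesis Dpl : planar D.
Hint Resolve same_refl : core.

(** Multiplication by [v_-] on the circle of [e]. *)
Definition mulX s e (x : label -> int) : label -> int :=
  fun l => if l e then 0 else x (raise s e l).

(** The Frobenius relation: multiplication and comultiplication of Z[X]/(X^2) are module maps for
    the action of X at any edge. *)
Lemma edge_map_mulX s k e (x : label -> int) l' :
  s k = false -> valid (on s k, l') ->
  edge_map k s (mulX s e x) l' = mulX (on s k) e (edge_map k s x) l'.
Proof.
set t := on s k; set a := arc1 k; set b := arc3 k => sk vl'.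
have vr : valid (t, raise t e l') by apply: valid_raise.
have /validP vl := vl'.
case: (boolP (splits s k)) => [sp|nsp].
  have sE := same_on_split Dpl sk sp; rewrite -/t in sE.
  have nab : same_circle t a b = false.
    by have := splits_on Dpl sk; rewrite sp.
  have nba : same_circle t b a = false by rewrite same_sym.
  have sub f g : same_circle t f g -> same_circle s f g by rewrite sE => ->.
  rewrite edge_map_split // /mulX edge_map_split // -/a -/b.
  case: (boolP (near t k e)) => [ne|nne].
    have ae : same_circle s a e.
      by case/orP: ne => /sub // h; apply: same_trans sp h.
    have -> : raise s a l' e = true by rewrite ffunE ae.
    have rE : raise s a (raise t e l') = raise s a l'.
      apply/ffunP=> f; rewrite !ffunE.
      case: (boolP (same_circle s a f)) => //= naf.
      case: (boolP (same_circle t e f)) => //= /sub ef.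
      by rewrite (same_trans ae ef) in naf.
    rewrite rE -(raise_same ae) !ffunE.
    case/orP: ne => h.
      rewrite -(vl _ _ h) !(same_sym t e) h.
      by rewrite (same_sym t b) -(same_eqr b h) nab; case: (l' a); case: (l' b).
    rewrite -(vl _ _ h) !(same_sym t e) h.
    by rewrite (same_sym t a) -(same_eqr a h) nba; case: (l' a); case: (l' b).
  have [nae nbe] : same_circle t a e = false /\ same_circle t b e = false.
    by move: nne; rewrite negb_or => /andP[/negbTE ? /negbTE ?].
  have rE : raise t e l' = raise s e l'.
    by apply/ffunP=> f; rewrite !ffunE sE (negPf nne) orbF.
  have sae : same_circle s a e = false by rewrite sE (negPf nne) andbF orbF.
  rewrite -rE !ffunE sae !(same_sym t e) nae nbe /=.
  case: (l' e) => /=; first by case: (l' a); case: (l' b).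
  by rewrite rE raiseC.
have sE := same_on_merge Dpl sk nsp; rewrite -/t in sE.
have nab : same_circle s a b = false by exact/negbTE.
have nba : same_circle s b a = false by rewrite same_sym.
have sub f g : same_circle s f g -> same_circle t f g by rewrite sE => ->.
have tab : same_circle t a b by rewrite -/(splits t k) splits_on.
have lab : l' a = l' b by apply: vl.
rewrite edge_map_merge // /mulX edge_map_merge // -/a -/b.
have rE : raise t e l' = if near s k e then raise s a (raise s b l') else raise s e l'.
  apply/ffunP=> f; case: ifP => ne; rewrite !ffunE sE ne /= ?orbF // /near.
  case: (boolP (same_circle s e f)) => [ef|_] //=; last by rewrite orbA.
  by move: ne; rewrite /near !(same_sym s _ e) !(same_eqr _ ef) !(same_sym s f) orbA => ->.
case: (boolP (near s k e)) rE => [ne|nne] rE.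
  have tae : same_circle t a e.
    by case/orP: ne => /sub //; apply: same_trans tab.
  have ele : l' e = l' a by rewrite (vl _ _ tae).
  have la : raise t e l' a = true by rewrite rE !ffunE same_refl.
  rewrite la ele rE; case: ifP => l'a; first by rewrite l'a.
    have l'b : l' b = false by rewrite -lab.
  case/orP: ne => h.
    have -> : raise s a l' e = true by rewrite ffunE h.
    have -> : raise s b l' e = false.
      by rewrite ffunE ele l'a orbF same_sym -(same_eqr b h).
    by rewrite add0r -(raise_same h).
  have -> : raise s b l' e = true by rewrite ffunE h.
  have -> : raise s a l' e = false.
    by rewrite ffunE ele l'a orbF same_sym -(same_eqr a h).
  by rewrite addr0 -(raise_same h) raiseC.
have [nae nbe] : same_circle s a e = false /\ same_circle s b e = false.
  by move: nne; rewrite negb_or => /andP[/negbTE ? /negbTE ?].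
rewrite rE !ffunE (same_sym s e) nae nbe /=.
case: (l' e) => /=; first by case: ifP => //.
by case: ifP => // _; rewrite !(raiseC s e).
Qed.



Lemma mulX_C u e f (z : label -> int) l : valid (u, l) ->
  mulX u e (mulX u f z) l = mulX u f (mulX u e z) l.
Proof.
move=> /validP vl; rewrite /mulX !ffunE raiseC (same_sym u f e).
case: (boolP (same_circle u e f)) => [/vl -> //|_] /=.
by case: (l e); case: (l f).
Qed.

Lemma mulX_same u e f (z : label -> int) l : valid (u, l) -> same_circle u e f ->
  mulX u e z l = mulX u f z l.
Proof. by move=> /validP vl ef; rewrite /mulX (vl _ _ ef) (raise_same ef). Qed.

Definition delta l0 : label -> int := fun l => (l == l0)%:Z.
Definition one : label -> int := delta [ffun=> true].

Lemma oneE e l : l e = false -> one l = 0.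
Proof.
by move=> le; rewrite /one /delta; case: eqP => // h; rewrite h ffunE in le.
Qed.

Lemma edge_map_delta k s (x : label -> int) l' :
  edge_map k s x l' = \sum_(l | valid (s, l)) x l * edge_map k s (delta l) l'.
Proof.
rewrite /edge_map big_mkcondr; apply: eq_bigr => l vl.
rewrite (big_mkcond (fun i => valid _ && _)) (bigD1 l) //= vl big1 ?addr0 /delta.
  by rewrite eqxx; case: ifP; rewrite ?mulr1 ?mulr0.
by move=> i /negPf ->; case: ifP.
Qed.

(** The functions on the labels of [s] form a cyclic module over the operators
    [mulX s e], generated by [one]. *)
Lemma cyclic_eq s u (F G : (label -> int) -> label -> int) :
  (forall x l, valid (u, l) ->
    F x l = \sum_(l0 | valid (s, l0)) x l0 * F (delta l0) l) ->
  (forall x l, valid (u, l) ->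
    G x l = \sum_(l0 | valid (s, l0)) x l0 * G (delta l0) l) ->
  (forall e x l, valid (u, l) -> F (mulX s e x) l = mulX u e (F x) l) ->
  (forall e x l, valid (u, l) -> G (mulX s e x) l = mulX u e (G x) l) ->
  (forall l, valid (u, l) -> F one l = G one l) ->
  forall x l, valid (u, l) -> F x l = G x l.
Proof.
move=> Fs Gs FX GX FG1 x l vl; rewrite Fs // Gs //.
apply: eq_bigr => l0 vl0; congr (_ * _).
(* Induction on the number of edges labelled v_-: raising a circle to v_+ lowers it, and [mulX]
   restores the label. *)
have [n] := ubnP #|[pred e | ~~ l0 e]|; elim: n l0 vl0 l vl => // n IH l0 vl0 l vl ln.
case: (pickP [pred e | ~~ l0 e]) => [e /= le|l01]; last first.
  have -> : l0 = [ffun=> true].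
    by apply/ffunP=> e; rewrite ffunE; apply/negbFE/l01.
  exact: FG1.
have ext l1 : valid (s, l1) -> delta l0 l1 = mulX s e (delta (raise s e l0)) l1.
  move=> /validP vl1; rewrite /delta /mulX; case: ifP => l1e.
    by case: eqP => // h; rewrite -h l1e in le.
  congr (Posz (nat_of_bool _)); apply/eqP/eqP=> [-> //|/ffunP h].
  apply/ffunP=> f; move: (h f); rewrite !ffunE.
  case: (boolP (same_circle s e f)) => // ef _.
  by move: vl0 => /validP vl0; rewrite -(vl1 _ _ ef) l1e -(vl0 _ _ ef) (negPf le).
have step H : (forall x l, valid (u, l) ->
    H x l = \sum_(l0 | valid (s, l0)) x l0 * H (delta l0) l) ->
  (forall e x l, valid (u, l) -> H (mulX s e x) l = mulX u e (H x) l) ->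
  H (delta l0) l = mulX u e (H (delta (raise s e l0))) l.
  move=> Hs HX; rewrite -HX // Hs // [RHS]Hs //.
  by apply: eq_bigr => l1 vl1; rewrite ext.
rewrite (step F) // (step G) // /mulX; case: ifP => // _; apply: IH.
- exact: valid_raise.
- exact: valid_raise.
- rewrite ltnS in ln; apply: leq_trans ln; apply: proper_card; apply/properP; split.
    apply/subsetP=> f; rewrite !inE ffunE; by case: (same_circle s e f).
  by exists e; rewrite !inE ?ffunE ?same_refl.
Qed.

Definition factor (b : bool) u e f (z : label -> int) : label -> int :=
  fun l => if b then mulX u e z l + mulX u f z l else z l.

Lemma factor_ext b u e f (y z : label -> int) :
  (forall l, valid (u, l) -> y l = z l) ->
  forall l, valid (u, l) -> factor b u e f y l = factor b u e f z l.
Proof.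
move=> yz l vl; rewrite /factor /mulX; case: b; last exact: yz.
by congr (_ + _); case: ifP => // _; apply: yz; apply: valid_raise.
Qed.

Lemma mulXD u e (y z : label -> int) l :
  mulX u e (fun l => y l + z l) l = mulX u e y l + mulX u e z l.
Proof. by rewrite /mulX; case: ifP; rewrite ?addr0. Qed.

Lemma factorC b b' u e f e' f' (z : label -> int) l : valid (u, l) ->
  factor b u e f (factor b' u e' f' z) l = factor b' u e' f' (factor b u e f z) l.
Proof.
move=> vl; rewrite /factor; case: b; case: b' => //.
by rewrite !mulXD !(mulX_C e) // !(mulX_C f) // addrACA.
Qed.

Lemma edge_map_one k s l' : s k = false -> valid (on s k, l') ->
  edge_map k s one l' = factor (splits s k) (on s k) (arc1 k) (arc3 k) one l'.
Proof.
move=> sk vl'; have /validP vl := vl'.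
have so := splits_on Dpl sk.
rewrite /factor /mulX; case: (boolP (splits s k)) => [sp|nsp].
  have sE := same_on_split Dpl sk sp.
  rewrite edge_map_split //.
  have nab : same_circle (on s k) (arc1 k) (arc3 k) = false.
    by rewrite -/(splits (on s k) k) so sp.
  have nba : same_circle (on s k) (arc3 k) (arc1 k) = false by rewrite same_sym.
  have rE : raise s (arc1 k) l' =
            raise (on s k) (arc1 k) (raise (on s k) (arc3 k) l').
    apply/ffunP=> f; rewrite !ffunE sE /near same_refl /=.
    by case: (same_circle _ (arc1 k) f).
  case la: (l' (arc1 k)); case lb: (l' (arc3 k)) => //=.
  - rewrite add0r rE; congr one; apply/ffunP=> f; rewrite !ffunE.
    by case: (boolP (same_circle (on s k) (arc1 k) f)) => // /vl <-; rewrite la orbT.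
  - rewrite addr0 rE raiseC; congr one; apply/ffunP=> f; rewrite !ffunE.
    by case: (boolP (same_circle (on s k) (arc3 k) f)) => // /vl <-; rewrite lb orbT.
  - rewrite (oneE la) (@oneE (arc3 k)) ?(@oneE (arc1 k)) ?addr0 //.
      by rewrite ffunE nba.
    by rewrite ffunE nab.
rewrite edge_map_merge //; case: ifP => // la.
have lb : l' (arc3 k) = false.
  by rewrite -la; apply/esym/vl; rewrite -/(splits (on s k) k) so.
rewrite (oneE la) (@oneE (arc3 k)) ?(@oneE (arc1 k)) ?addr0 //.
  by rewrite ffunE same_sym la orbF; apply/negbTE.
by rewrite ffunE lb orbF; apply/negbTE.
Qed.

Lemma edge_map2_delta s k m (x : label -> int) l :
  edge_map m (on s k) (edge_map k s x) l =
  \sum_(l0 | valid (s, l0)) x l0 * edge_map m (on s k) (edge_map k s (delta l0)) l.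
Proof.
rewrite edge_map_delta.
under eq_bigr do rewrite edge_map_delta big_distrl /=.
rewrite exchange_big /=; apply: eq_bigr => l0 vl0.
rewrite [in RHS]edge_map_delta big_distrr /=.
by apply: eq_bigr => l1 _; rewrite mulrA.
Qed.

Lemma edge_map2_one s k m l : k != m -> s k = false -> s m = false ->
  valid (on (on s k) m, l) ->
  edge_map m (on s k) (edge_map k s one) l =
  factor (splits s k) (on (on s k) m) (arc1 k) (arc3 k)
    (factor (splits (on s k) m) (on (on s k) m) (arc1 m) (arc3 m) one) l.
Proof.
move=> km sk sm vl.
have tm : on s k m = false by rewrite on_neq // eq_sym.
have F1 l1 : valid (on (on s k) m, l1) ->
    edge_map m (on s k) one l1 =
    factor (splits (on s k) m) (on (on s k) m) (arc1 m) (arc3 m) one l1.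
  exact: edge_map_one.
rewrite -(factor_ext _ _ _ F1) //.
rewrite (@edge_map_ext _ _ _ _ (factor (splits s k) (on s k) (arc1 k) (arc3 k) one)); last first.
  by move=> l1 vl1; apply: edge_map_one.
rewrite /factor; case: ifP => // _.
rewrite -!edge_map_mulX //.
have := edge_map_lin m (on s k) (mulX (on s k) (arc1 k) one) (mulX (on s k) (arc3 k) one) 1 1 l.
by rewrite !mul1r => <-; apply: edge_map_ext => l1 _; rewrite !mul1r.
Qed.

Lemma face_comm s k m (x : label -> int) l : k != m -> s k = false -> s m = false ->
  valid (on (on s k) m, l) ->
  edge_map m (on s k) (edge_map k s x) l = edge_map k (on s m) (edge_map m s x) l.
Proof.
move=> km sk sm; move: x l.
have tm : on s k m = false by rewrite on_neq // eq_sym.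
have tk : on s m k = false by rewrite on_neq.
have mk : m != k by rewrite eq_sym.
set u := on (on s k) m; have uE : u = on (on s m) k by exact: onC.
apply: (@cyclic_eq s u).
- by move=> x l _; rewrite edge_map2_delta.
- by move=> x l _; rewrite edge_map2_delta.
- move=> e x l vl; rewrite -edge_map_mulX //; apply: edge_map_ext => l1 vl1.
  by rewrite edge_map_mulX.
- move=> e x l vl; rewrite uE -edge_map_mulX -?uE //; apply: edge_map_ext => l1 vl1.
  by rewrite edge_map_mulX.
move=> l vl; rewrite edge_map2_one // edge_map2_one // -?uE // -/u.
have [c cP] := Dpl.
have [[kk ck] [mm cm]] := (cP _ _ sk, cP _ _ sm).
have [[um cum] [uk cuk]] := (cP _ _ tm, cP _ _ tk).
rewrite -/u in um cum; rewrite -uE in uk cuk.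
(* Both paths lead from [s] to the same state, so the circle count forces them to contain equally
   many splits. Apart from the two cases below, both sides are the same product of factors. *)
move: cum; rewrite cuk ck cm.
case: (boolP (splits s k)) ck kk => K0 _ _; case: (boolP (splits (on s k) m)) um => M1 um;
case: (boolP (splits s m)) cm mm => M0 _ _; case: (boolP (splits (on s m) k)) uk cuk => K1 uk _ cE;
  try (by exfalso; move: cE; clear; lia); try exact: factorC; rewrite /factor.
(* Both paths split and then merge: the arcs of [k] and [m] end on a single circle, and both sides
   are 2X of that circle. *)
- have Q : near (on s m) m (arc1 k).
    move: (K0); rewrite /splits (same_on_split Dpl sm M0) -/(splits (on s m) k).
    by rewrite (negPf K1) => /andP[].
  have sub e f : same_circle (on s m) e f -> same_circle u e f.
    by rewrite uE (same_on_merge Dpl tk K1) => ->.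
  have am : same_circle u (arc1 m) (arc1 k).
    by case/orP: Q => /sub // h; apply: same_trans h.
  rewrite -!(mulX_same one vl am) -(mulX_same one vl um) -(mulX_same one vl uk).
  by rewrite -!(mulX_same one vl am).
(* Both paths merge and then split: the two final circles through [k] are the two through [m],
   possibly in the other order, so the sums X_a + X_b agree. *)
- have sub e f : same_circle s e f -> same_circle (on s k) e f.
    by rewrite (same_on_merge Dpl sk K0) => ->.
  have : near s m (arc1 k) && near s m (arc3 k).
    by move: K1; rewrite /splits (same_on_merge Dpl sm M0) -/(splits s k) (negPf K0).
  have tr e : near s m e -> near u m e.
    move=> ne; have : same_circle (on s k) (arc1 m) e.
      by case/orP: ne => /sub // h; exact: (same_trans M1 h).
    by rewrite (same_on_split Dpl tm M1) -/u => /orP[h|/andP[]//]; rewrite /near h.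
  case/andP=> /tr h1 /tr h3.
  have nk e : same_circle u e (arc1 k) -> same_circle u e (arc3 k) = false.
    by move=> h; rewrite (same_eqr _ h) -/(splits u k) uk.
  case/orP: h1 => h1.
    case/orP: h3 => h3; first by rewrite nk in h3.
    by rewrite (mulX_same one vl h1) (mulX_same one vl h3).
  case/orP: h3 => h3; last by rewrite nk in h3.
  by rewrite (mulX_same one vl h1) (mulX_same one vl h3) addrC.
Qed.

End Faces.

(** * Exactness of subcubes *)

Section Complex.
Variable D : link_diagram.
Local Notation edge := (link_edge D).
Local Notation crossing := 'I_(link_ncross D).
Local Notation label := {ffun edge -> bool}.
Implicit Types (s t : state D) (k m a : crossing) (e f : edge) (l : label).
Implicit Types (U : {set crossing}) (X Y : state D -> label -> int).
Hypothesis Dpl : planar D.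
Hint Resolve same_refl : core.

(** The differential in the directions of [U] only. The signs remain those of the whole cube, so
    passing to a face changes no sign. *)
Definition cube_diff U X : state D -> label -> int := fun s l =>
  \sum_(k | (k \in U) && s k) edge_sign k (off s k) * edge_map k (off s k) (X (off s k)) l.

Lemma edge_sign_on k m s : k != m -> s k = false ->
  edge_sign m (on s k) = if (k < m)%N then - edge_sign m s else edge_sign m s.
Proof.
move=> km sk; rewrite /edge_sign; case: ifP => km'.
  rewrite (cardD1 k) inE on_id km' /= exprS mulN1r; congr (- _ ^+ _).
  apply: eq_card => n; rewrite !inE ffunE.
  by case: (n =P k) => [->|//]; rewrite sk andbF.
congr (_ ^+ _); apply: eq_card => n; rewrite !inE ffunE.
by case: (n =P k) => [->|//]; rewrite km'.
Qed.

Lemma edge_sign2 k s : edge_sign k s * edge_sign k s = 1.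
Proof. by rewrite -expr2 sqrr_sign. Qed.

Lemma edge_signC k m s : k != m -> s k = false -> s m = false ->
  edge_sign k s * edge_sign m (on s k) = - (edge_sign m s * edge_sign k (on s m)).
Proof.
move=> km sk sm; rewrite (edge_sign_on km sk) (@edge_sign_on m k) 1?eq_sym //.
case: (ltngtP k m) => [_|_|/val_inj h]; last by rewrite h eqxx in km.
  by rewrite mulrN mulrC.
by rewrite mulrN opprK mulrC.
Qed.

Lemma cube_diff_ext U X Y s l :
  (forall k l, k \in U -> s k -> valid (off s k, l) -> X (off s k) l = Y (off s k) l) ->
  cube_diff U X s l = cube_diff U Y s l.
Proof.
move=> XY; apply: eq_bigr => k /andP[kU sk]; congr (_ * _).
by apply: edge_map_ext => l1; apply: XY.
Qed.

Lemma cube_diffB U X Y s l :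
  cube_diff U (fun s l => X s l - Y s l) s l = cube_diff U X s l - cube_diff U Y s l.
Proof.
rewrite /cube_diff -sumrB; apply: eq_bigr => k _; rewrite -mulrBr; congr (_ * _).
by rewrite /edge_map -sumrB.
Qed.

Lemma cube_diff0 U s l : cube_diff U (fun _ _ => 0) s l = 0.
Proof. by rewrite /cube_diff big1 // => k _; rewrite /edge_map big1 ?mulr0. Qed.

Lemma cube_diffK U X s l : valid (s, l) -> cube_diff U (cube_diff U X) s l = 0.
Proof.
move=> vl.
(* The contribution of the path that changes [m] and then [k]. It is antisymmetric in [k] and [m],
   so the double sum equals its own negative. *)
pose T k m : int := if [&& k \in U, m \in U, s k, s m & k != m] then
  edge_sign k (off s k) * (edge_sign m (off (off s k) m) *
    edge_map k (off s k) (edge_map m (off (off s k) m) (X (off (off s k) m))) l) else 0.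
have TC k m : T k m = - T m k.
  rewrite /T; case: (boolP [&& _, _, _, _ & _]) => [|h]; last first.
    rewrite ifF ?oppr0 //; apply: contraNF h => /and5P[-> -> -> -> h].
    by rewrite eq_sym.
  case/and5P=> kU mU sk sm km; rewrite kU mU sk sm [m == k]eq_sym km /=.
  rewrite (offC s m k); set t := off (off s k) m.
  have tm : t m = false by rewrite off_id.
  have tk : t k = false by rewrite off_neq // off_id.
  have sE : on (on t k) m = s.
    rewrite /t onC offK; last by rewrite off_neq // eq_sym.
    by rewrite offK.
  have skE : off s k = on t m by rewrite /t offK // off_neq // eq_sym.
  have smE : off s m = on t k by rewrite /t offC offK // off_neq.
  rewrite skE smE (face_comm Dpl _ km) // ?sE // !mulrA -mulNr; congr (_ * _).
  by rewrite mulrC edge_signC 1?eq_sym // mulrC.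
have -> : cube_diff U (cube_diff U X) s l = \sum_k \sum_m T k m.
  rewrite /cube_diff big_mkcond; apply: eq_bigr => k _.
  case: (boolP ((k \in U) && s k)) => [/andP[kU sk]|h]; last first.
    by rewrite big1 // => m _; rewrite /T; case: ifP => // /and5P[h1 _ h2 _ _]; rewrite h1 h2 in h.
  rewrite /edge_map exchange_big /= big_distrr big_mkcond /=.
  apply: eq_bigr => m _; rewrite /T kU sk ffunE /= [k == m]eq_sym.
  case: (m \in U); case: (s m); rewrite /= ?andbF //=; case: (m != k) => //=.
  by rewrite -big_distrr.
have : \sum_k \sum_m T k m = - \sum_k \sum_m T k m.
  rewrite {1}exchange_big /= -sumrN; apply: eq_bigr => k _.
  by rewrite -sumrN; apply: eq_bigr => m _; rewrite TC.
by move=> h; clear -h; lia.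
Qed.

Definition in_cube U s0 s := forall m, m \notin U -> s m = s0 m.
Definition cube_weight U s := #|[pred m in U | s m]|.

(** No quantum degree is fixed. For [w = 0] the condition says that the differential is injective,
    because no edge of the cube ends in weight 0. *)
Definition exact_at U s0 w := forall X,
  (forall s l, in_cube U s0 s -> cube_weight U s = w.+1 -> valid (s, l) ->
    cube_diff U X s l = 0) ->
  exists Y, forall s l, in_cube U s0 s -> cube_weight U s = w -> valid (s, l) ->
    X s l = cube_diff U Y s l.

Lemma cube_diffD1 U X a s l : a \in U -> cube_diff U X s l =
  (if s a then edge_sign a (off s a) * edge_map a (off s a) (X (off s a)) l else 0)
  + cube_diff (U :\ a) X s l.
Proof.
move=> aU; rewrite /cube_diff; case: ifP => sa.
  rewrite (bigD1 a) ?aU //=; congr (_ + _); apply: eq_bigl => k.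
  by rewrite !inE; case: (k == a); rewrite ?andbF ?andbT.
rewrite add0r; apply: eq_bigl => k; rewrite !inE.
by case: (k =P a) => [->|//]; rewrite sa andbF.
Qed.

Lemma cube_weightD1 U a s : a \in U -> cube_weight U s = (s a + cube_weight (U :\ a) s)%N.
Proof.
move=> aU; rewrite /cube_weight (cardD1 a) !inE aU /=; congr (_ + _)%N.
by apply: eq_card => k; rewrite !inE; case: (k == a).
Qed.

Lemma in_cubeD1 U a s0 s : s0 a = false -> a \in U ->
  in_cube (U :\ a) s0 s <-> in_cube U s0 s /\ s a = false.
Proof.
move=> sa aU; split=> [h|[h sa'] m].
  split=> [m mU|]; last by rewrite h // !inE eqxx.
  by apply: h; rewrite !inE (negPf mU) andbF.
by rewrite !inE negb_and negbK => /orP[/eqP ->|/h //]; rewrite sa' sa.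
Qed.

Lemma in_cubeD1_on U a s0 s : a \in U ->
  in_cube (U :\ a) (on s0 a) s <-> in_cube U s0 s /\ s a.
Proof.
move=> aU; split=> [h|[h sa'] m].
  split=> [m mU|]; last by rewrite h ?on_id // !inE eqxx.
  rewrite h; last by rewrite !inE (negPf mU) andbF.
  by rewrite on_neq //; apply: contraNneq mU => ->.
rewrite !inE negb_and negbK; have [-> _|ma /= /h ->] := eqVneq m a.
  by rewrite on_id.
by rewrite on_neq.
Qed.

Lemma in_cube_off U s0 s k : in_cube U s0 s -> k \in U -> in_cube U s0 (off s k).
Proof.
move=> h kU m mU; rewrite off_neq ?h //; apply: contraNneq mU => -> //.
Qed.

Lemma cube_weight_off U s k : k \in U -> s k -> cube_weight U s = (cube_weight U (off s k)).+1.
Proof.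
move=> kU sk; rewrite !(cube_weightD1 _ kU) sk off_id add1n; congr _.+1.
by apply: eq_card => m; rewrite !inE; case: (m =P k) => //= /eqP mk; rewrite off_neq.
Qed.

Lemma cocycle_off U s0 w a X : a \in U -> s0 a = false ->
  (forall s l, in_cube U s0 s -> cube_weight U s = w -> valid (s, l) ->
    cube_diff U X s l = 0) ->
  forall s l, in_cube (U :\ a) s0 s -> cube_weight (U :\ a) s = w -> valid (s, l) ->
    cube_diff (U :\ a) X s l = 0.
Proof.
move=> aU sa dX s l /in_cubeD1[]// sU sa' ws vl.
have := dX s l sU; rewrite (cube_diffD1 _ _ _ aU) sa' add0r; apply => //.
by rewrite (cube_weightD1 _ aU) sa'.
Qed.

(** The zigzag of the long exact sequence for the two faces of [a]: a coboundary clears [X] on the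
    face where [a] is 0, and the remainder is a cocycle of the other face. It is separate from
    [exact_step] because the nonzero homology in weight 1 is found through it as well. *)
Lemma cocycle_move U s0 w a X : a \in U -> s0 a = false ->
  (forall s l, in_cube U s0 s -> cube_weight U s = w.+2 -> valid (s, l) ->
    cube_diff U X s l = 0) ->
  (exists Y, forall s l, in_cube (U :\ a) s0 s -> cube_weight (U :\ a) s = w.+1 ->
    valid (s, l) -> X s l = cube_diff (U :\ a) Y s l) ->
  exists Z,
  (forall s l, in_cube U s0 s -> cube_weight U s = w.+1 -> valid (s, l) ->
    s a = false -> X s l = cube_diff U Z s l) /\
  (forall s l, in_cube (U :\ a) (on s0 a) s -> cube_weight (U :\ a) s = w.+1 ->
    valid (s, l) -> cube_diff (U :\ a) (fun s l => X s l - cube_diff U Z s l) s l = 0).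
Proof.
move=> aU sa dX [Y0 XY0].
pose Z s l := if s a then 0 else Y0 s l.
have XZ s l : in_cube U s0 s -> cube_weight U s = w.+1 -> valid (s, l) -> s a = false ->
    X s l = cube_diff U Z s l.
  move=> sU ws vl sa'; rewrite (cube_diffD1 _ _ _ aU) sa' add0r XY0 //.
  - apply: cube_diff_ext => k l1; rewrite !inE => /andP[ka kU] sk _.
    by rewrite /Z off_neq 1?eq_sym // sa'.
  - exact/in_cubeD1.
  - by rewrite (cube_weightD1 _ aU) sa' add0n in ws.
exists Z; split=> // s l.
move=> /in_cubeD1_on; case=> // sU sa' ws vl.
have ws' : cube_weight U s = w.+2 by rewrite (cube_weightD1 _ aU) sa' ws.
have := cube_diffB U X (cube_diff U Z) s l.
rewrite cube_diffK // dX // subrr (cube_diffD1 _ _ _ aU) sa'.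
(* The component of the differential along [a] drops out, since [X] minus the coboundary of [Z]
   vanishes where [a] is 0. *)
rewrite (@edge_map_ext _ _ _ _ (fun _ => 0)) ?[edge_map _ _ _ _]big1 ?mulr0 ?add0r //.
move=> l1 vl1; rewrite -XZ ?subrr ?off_id //; first exact: in_cube_off.
by apply: succn_inj; rewrite -cube_weight_off.
Qed.

(** The last hypothesis asks for a primitive of this [X] on the face rather than for exactness of
    the face: [exact_kink] obtains the primitive from the cocycle equation of the larger cube. *)
Lemma exact_step U s0 w a X : a \in U -> s0 a = false ->
  exact_at (U :\ a) (on s0 a) w ->
  (forall s l, in_cube U s0 s -> cube_weight U s = w.+2 -> valid (s, l) ->
    cube_diff U X s l = 0) ->
  (exists Y, forall s l, in_cube (U :\ a) s0 s -> cube_weight (U :\ a) s = w.+1 ->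
    valid (s, l) -> X s l = cube_diff (U :\ a) Y s l) ->
  exists Y, forall s l, in_cube U s0 s -> cube_weight U s = w.+1 -> valid (s, l) ->
    X s l = cube_diff U Y s l.
Proof.
move=> aU sa E1 dX XY0; have [Z [XZ /E1[Y1 XY1]]] := cocycle_move aU sa dX XY0.
exists (fun s l => Z s l + (if s a then Y1 s l else 0)) => s l sU ws vl.
have -> : cube_diff U (fun s l => Z s l + (if s a then Y1 s l else 0)) s l =
    cube_diff U Z s l + cube_diff U (fun s l => if s a then Y1 s l else 0) s l.
  have := cube_diffB U (fun s l => Z s l + (if s a then Y1 s l else 0)) Z s l.
  rewrite (@cube_diff_ext _ _ (fun s l => if s a then Y1 s l else 0)).
    by move=> ->; rewrite addrC subrK.
  by move=> *; rewrite addrC addKr.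
rewrite [X in _ + X](cube_diffD1 _ _ _ aU).
case sa': (s a).
  rewrite (@edge_map_ext _ _ _ _ (fun _ => 0)); last by move=> l1 _; rewrite off_id.
  rewrite [edge_map _ _ _ _]big1 ?mulr0 ?add0r //.
  rewrite -[LHS](subrK (cube_diff U Z s l)) XY1 //.
  - rewrite addrC; congr (_ + _); apply: cube_diff_ext => k l1; rewrite !inE => /andP[ka kU] sk _.
    by rewrite off_neq 1?eq_sym // sa'.
  - exact/in_cubeD1_on.
  - by move: ws; rewrite (cube_weightD1 _ aU) sa' => -[].
rewrite add0r -XZ // (@cube_diff_ext _ _ (fun _ _ => 0)) ?cube_diff0 ?addr0 //.
move=> k l1; rewrite !inE => /andP[ka kU] sk _.
by rewrite off_neq 1?eq_sym // sa'.
Qed.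

(** Long exact sequence of the two faces; the weight drops on the second one because [a] itself no
    longer counts. *)
Lemma exactS U s0 w a : a \in U -> s0 a = false ->
  exact_at (U :\ a) s0 w.+1 -> exact_at (U :\ a) (on s0 a) w -> exact_at U s0 w.+1.
Proof.
move=> aU sa E0 E1 X dX; apply: (exact_step aU sa E1 dX); apply: E0.
exact: cocycle_off dX.
Qed.

Lemma cube_weight0 U s0 s : (forall k, k \in U -> s0 k = false) ->
  in_cube U s0 s -> cube_weight U s = 0%N -> s = s0.
Proof.
move=> U0 sU /card0_eq ws; apply/ffunP=> m; case: (boolP (m \in U)) => mU.
  by have := ws m; rewrite !inE mU /= => ->; rewrite U0.
exact: sU.
Qed.

Lemma cube_weight_on U s0 a : (forall k, k \in U -> s0 k = false) -> a \in U ->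
  cube_weight U (on s0 a) = 1%N.
Proof.
move=> U0 aU; rewrite (cube_weight_off (k := a)) ?on_id // onK ?U0 //.
by congr _.+1; apply: eq_card0 => k; rewrite !inE; apply/negP=> /andP[/U0 ->].
Qed.

Lemma in_cube_on U s0 a : a \in U -> in_cube U s0 (on s0 a).
Proof. by move=> aU m mU; rewrite on_neq //; apply: contraNneq mU => ->. Qed.

Lemma cube_diff_on U s0 a X l : (forall k, k \in U -> s0 k = false) -> a \in U ->
  cube_diff U X (on s0 a) l = edge_sign a s0 * edge_map a s0 (X s0) l.
Proof.
move=> U0 aU; rewrite /cube_diff (big_pred1 a) ?onK ?U0 // => k.
rewrite /= ffunE; have [->|ka] := eqVneq k a; first by rewrite aU.
by apply/negP=> /andP[/U0 ->].
Qed.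

(** Comultiplication followed by reading the coefficient of v_- on the circle of [arc3 a] is the
    identity; [l'] below is the label that does this. *)
Lemma edge_map_split_inj a s (x : label -> int) : s a = false -> splits s a ->
  (forall l, valid (on s a, l) -> edge_map a s x l = 0) ->
  forall l, valid (s, l) -> x l = 0.
Proof.
move=> sa sp dx l vl; have /validP h := vl.
have nab : same_circle (on s a) (arc3 a) (arc1 a) = false.
  by have := splits_on Dpl sa; rewrite sp /splits same_sym.
have sE := same_on_split Dpl sa sp.
pose l' : {ffun edge -> bool} := [ffun e => ~~ same_circle (on s a) (arc3 a) e && l e].
have vl' : valid (on s a, l').
  apply/validP=> e f ef; rewrite !ffunE (h e f); last by rewrite sE ef.
  by rewrite 2!(same_sym _ (arc3 a)) (same_eqr _ ef).
have := dx _ vl'; rewrite edge_map_split // !ffunE same_refl nab /= andbF orbF.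
case la : (l (arc1 a)) => <-; congr x; apply/ffunP=> e; rewrite !ffunE.
  case: (boolP (same_circle s (arc1 a) e)) => [/h <- //|nae] /=.
  case: (boolP (same_circle _ _ e)) => // h3; exfalso; move: nae; rewrite sE.
  by rewrite /near same_refl h3 orbT orbT.
case: (boolP (same_circle _ _ e)) => // h3.
by rewrite -(h (arc3 a) e) ?sE ?h3 // -(h _ _ sp) la.
Qed.

(** In weight 0 there is only the state [s0], and one injective component already makes the
    differential injective. *)
Lemma exact_split U s0 a : (forall k, k \in U -> s0 k = false) -> a \in U ->
  splits s0 a -> exact_at U s0 0.
Proof.
move=> U0 aU sp X dX; exists (fun _ _ => 0) => s l sU ws.
rewrite (cube_weight0 U0 sU ws) cube_diff0 => vl {s sU ws}.
apply: (edge_map_split_inj (U0 _ aU) sp) vl => l1 vl1.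
have := dX _ _ (in_cube_on s0 aU) (cube_weight_on U0 aU) vl1.
rewrite cube_diff_on // => h.
by rewrite -[LHS]mul1r -(edge_sign2 a s0) -mulrA h mulr0.
Qed.

Definition lower a s l : label := [ffun e => ~~ same_circle (on s a) (arc1 a) e && l e].

Lemma valid_lower a s l : s a = false -> splits s a -> valid (s, l) ->
  valid (on s a, lower a s l).
Proof.
move=> sa sp /validP vl; apply/validP=> e f ef; rewrite !ffunE (vl e f).
  by rewrite 2!(same_sym _ (arc1 a)) (same_eqr _ ef).
by rewrite (same_on_split Dpl sa sp) ef.
Qed.

Lemma edge_map_lower a s (x : label -> int) l : s a = false -> splits s a ->
  valid (s, l) -> edge_map a s x (lower a s l) = x l.
Proof.
move=> sa sp vl; rewrite edge_map_split ?valid_lower // !ffunE same_refl /=.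
have nab : same_circle (on s a) (arc1 a) (arc3 a) = false.
  by have := splits_on Dpl sa; rewrite sp.
have sE := same_on_split Dpl sa sp; move/validP: vl => vl.
rewrite nab /= -(vl _ _ sp); case: ifP => la; congr x; apply/ffunP=> e; rewrite !ffunE.
  case: (boolP (same_circle s (arc1 a) e)) => [/vl <- //|nae] /=.
  case: (boolP (same_circle _ _ e)) => // h1; exfalso; move: nae; rewrite sE.
  by rewrite h1.
case: (boolP (same_circle _ _ e)) => // h1.
by rewrite -(vl (arc1 a) e) ?sE ?h1 // la.
Qed.

(** If the circle split off at [a] meets no other crossing, restricting to the
    label [v_-] on it is a retraction of the edge map at [a] which commutes with
    the other edge maps. *)
Lemma lower_edge_map a k s (x : label -> int) l : k != a -> s a = false -> s k = false ->
  splits s a -> splits (on s k) a ->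
  ~~ same_circle (on s a) (arc1 a) (arc1 k) -> ~~ same_circle (on s a) (arc1 a) (arc3 k) ->
  valid (on s k, l) ->
  edge_map k (on s a) x (lower a (on s k) l) = edge_map k s (fun l => x (lower a s l)) l.
Proof.
move=> ka sa sk sp spk n1 n3 vl.
have tk : on s a k = false by rewrite on_neq.
have ua : on s k a = false by rewrite on_neq 1?eq_sym.
have vl' := valid_lower ua spk vl; rewrite onC in vl'.
have sE := same_on_split Dpl sa sp.
have nk e : near (on s a) k e -> ~~ same_circle (on s a) (arc1 a) e.
  by case/orP=> h; rewrite same_sym -(same_eqr _ h) same_sym.
have sameE e f : ~~ same_circle (on s a) (arc1 a) e -> ~~ same_circle (on s a) (arc1 a) f ->
    same_circle s e f = same_circle (on s a) e f.
  move=> ne nf; rewrite sE /near (negPf ne) (negPf nf) /=.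
  case: (boolP (same_circle _ e f)) => //= nef; apply/negP=> /andP[h h'].
  by move/negP: nef; apply; rewrite -(same_eqr _ h).
have spE : splits (on s a) k = splits s k by rewrite /splits sameE.
have PE e : same_circle (on (on s k) a) (arc1 a) e = same_circle (on s a) (arc1 a) e.
  rewrite onC; case: (boolP (splits (on s a) k)) => [spa|nspa].
    rewrite (same_on_split Dpl tk spa).
    have -> : near (on (on s a) k) k (arc1 a) = false; last by rewrite orbF.
    apply/negP; rewrite /near => /orP[] h.
      by move: n1; rewrite same_sym (same_on_split Dpl tk spa) h.
    by move: n3; rewrite same_sym (same_on_split Dpl tk spa) h.
  rewrite (same_on_merge Dpl tk nspa).
  have -> : near (on s a) k (arc1 a) = false; last by rewrite orbF.
  by apply/negP => /nk; rewrite same_refl.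
have rE e : near (on s a) k e ->
    raise (on s a) e (lower a (on s k) l) = lower a s (raise s e l).
  move=> ne; apply/ffunP=> f; rewrite !ffunE PE.
  case: (boolP (same_circle (on s a) (arc1 a) f)) => nf /=.
    rewrite orbF; apply: contraNF (nk _ ne) => h.
    by apply: same_trans nf _; rewrite same_sym.
  by rewrite sameE // nk.
have l1 : lower a (on s k) l (arc1 k) = l (arc1 k) by rewrite ffunE PE (negPf n1).
have l3 : lower a (on s k) l (arc3 k) = l (arc3 k) by rewrite ffunE PE (negPf n3).
have n1' : near (on s a) k (arc1 k) by rewrite /near same_refl.
have n3' : near (on s a) k (arc3 k) by rewrite /near same_refl orbT.
have lE : lower a (on s k) l = lower a s l by apply/ffunP=> e; rewrite !ffunE PE.
case: (boolP (splits s k)) => spk'.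
  by rewrite !edge_map_split ?spE // l1 l3 rE // lE.
by rewrite !edge_map_merge ?spE // l1 !rE // lE.
Qed.

(** On a state with [a] smoothed, the cocycle equation expresses the image of [X] under the edge map
    of [a] by the other edge maps. The retraction turns this into a primitive of [X] on the face
    where [a] is 0, so only the other face has to be exact. *)
Lemma exact_kink U s0 w a : a \in U -> s0 a = false ->
  (forall s, in_cube (U :\ a) s0 s -> splits s a) ->
  (forall s k, in_cube (U :\ a) s0 s -> k \in U :\ a ->
    ~~ same_circle (on s a) (arc1 a) (arc1 k) /\ ~~ same_circle (on s a) (arc1 a) (arc3 k)) ->
  exact_at (U :\ a) (on s0 a) w -> exact_at U s0 w.+1.
Proof.
move=> aU sa sp free E1 X dX; apply: (exact_step aU sa E1 dX).
(* The retraction applied to [X] on the opposite face; the sign compensates the anticommutation of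
   the edge at [a] with the others. *)
exists (fun s l => edge_sign a s * X (on s a) (lower a s l)) => s l sU ws vl.
have [sU' sa'] := (in_cubeD1 s sa aU).1 sU.
have := dX (on s a) (lower a s l).
rewrite (cube_diffD1 _ _ _ aU) on_id onK // edge_map_lower ?sp //.
rewrite (cube_weightD1 _ aU) on_id add1n valid_lower ?sp // => H.
have {}H : edge_sign a s * X s l = - cube_diff (U :\ a) X (on s a) (lower a s l).
  apply/eqP; rewrite -subr_eq0 opprK H //.
    by move=> m mU; rewrite on_neq ?sU' //; apply: contraNneq mU => ->.
  rewrite -ws; congr _.+1; apply: eq_card => m; rewrite !inE.
  by case: (m =P a) => //= /eqP ma; rewrite on_neq.
rewrite -[LHS]mul1r -(edge_sign2 a s) -mulrA H mulrN -mulNr big_distrr /=.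
rewrite /cube_diff; apply: eq_big => [k|k].
  rewrite !inE; case: (k =P a) => //= /eqP ka; by rewrite on_neq.
rewrite !inE -andbA => /and3P[ka kU]; rewrite on_neq // => sk.
have kU' : k \in U :\ a by rewrite !inE ka.
have tU : in_cube (U :\ a) s0 (off s k) by apply: in_cube_off.
have ak : a != k by rewrite eq_sym.
rewrite -on_off //; set t := off s k.
have sE : s = on t k by rewrite /t offK.
have ta : t a = false by rewrite /t off_neq.
have tk : t k = false by rewrite off_id.
have [n1 n3] := free _ _ tU kU'.
rewrite {2}sE lower_edge_map // -?sE ?sp //.
have := edge_map_lin k t (fun l => X (on t a) (lower a t l)) (fun _ => 0) (edge_sign a t) 0 l.
rewrite !mul0r addr0 (@edge_map_ext _ _ _ _ (fun l0 => edge_sign a t * X (on t a) (lower a t l0))); last first.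
  by move=> l0 _; rewrite addr0.
move=> ->; rewrite !mulrA; congr (_ * _).
have := edge_signC ka tk ta; rewrite -sE => h.
rewrite -[LHS]mul1r -(edge_sign2 a t) -[RHS]mulr1 -(edge_sign2 a s).
by transitivity (edge_sign k t * edge_sign a s * (edge_sign a t * edge_sign a s));
  [rewrite h; ring | ring].
Qed.

End Complex.

(** * The quantum grading *)

Section Grading.
Variable D : link_diagram.
Local Notation edge := (link_edge D).
Local Notation crossing := 'I_(link_ncross D).
Local Notation label := {ffun edge -> bool}.
Implicit Types (s t : state D) (k m a : crossing) (e f : edge) (l : label).
Implicit Types (U : {set crossing}) (X Y : state D -> label -> int).
Hypothesis Dpl : planar D.
Hint Resolve same_refl : core.

Definition circle_sign (b : bool) : int := if b then 1 else -1.

Definition circle_sum s l : int :=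
  \sum_(c in circles s) circle_sign (circle_plus (s, l) c).

Definition circle_of s e := [set f | same_circle s e f].

Lemma circlesE s : circles s = [set circle_of s e | e in [set: edge]].
Proof.
apply/setP=> c; apply/imsetP/imsetP=> -[e _ ->]; exists e => //;
  by apply/setP=> f; rewrite !inE.
Qed.

Lemma eq_circle_of s e f : (circle_of s e == circle_of s f) = same_circle s e f.
Proof.
apply/eqP/idP=> [/setP/(_ f)|ef]; first by rewrite !inE same_refl.
by apply/setP=> g; rewrite !inE (same_eqr _ ef).
Qed.

Lemma circle_plus_of s l e : valid (s, l) -> circle_plus (s, l) (circle_of s e) = l e.
Proof.
move=> /validP vl; apply/existsP/idP=> [[f]|le].
  by rewrite inE => /andP[/vl ->].
by exists e; rewrite inE same_refl.
Qed.

(** Away from [k] both states have the same circles with the same labels, so what is left after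
    removing the circles through [k] agrees. The states are abstract in order to cover a split read
    backwards. *)
Lemma circle_sum_merge s t k l l' :
  (forall e f, same_circle t e f = same_circle s e f || (near s k e && near s k f)) ->
  ~~ splits s k -> valid (s, l) -> valid (t, l') ->
  (forall e, ~~ near s k e -> l e = l' e) ->
  circle_sum s l - circle_sign (l (arc1 k)) - circle_sign (l (arc3 k)) =
  circle_sum t l' - circle_sign (l' (arc1 k)).
Proof.
set a := arc1 k; set b := arc3 k => tE nsp vl vl' ll'.
have mem r e : circle_of r e \in circles r.
  by rewrite circlesE; apply/imsetP; exists e.
rewrite /circle_sum (bigD1 (circle_of s a)) //= (bigD1 (circle_of s b)) /=; last first.
  by rewrite mem eq_circle_of same_sym.
rewrite [X in _ = X - _](bigD1 (circle_of t a)) //= !circle_plus_of //.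
rewrite !(addrC (circle_sign _)) !addrK; apply: eq_big => c.
  rewrite !circlesE; apply/idP/idP.
    case/andP=> [/andP[/imsetP[e _ ->]]]; rewrite !eq_circle_of => nea neb.
    have ne : ~~ near s k e by rewrite /near negb_or !(same_sym s _ e) nea.
    have -> : circle_of s e = circle_of t e.
      by apply/setP=> f; rewrite !inE tE (negPf ne) orbF.
    rewrite eq_circle_of tE (negPf ne) orbF nea andbT.
    by apply/imsetP; exists e.
  case/andP=> [/imsetP[e _ ->]]; rewrite eq_circle_of tE /near.
  rewrite same_refl andbT negb_or => /andP[nea ne].
  have -> : circle_of t e = circle_of s e.
    by apply/setP=> f; rewrite !inE tE /near (negPf ne) orbF.
  rewrite !eq_circle_of nea; move: ne; rewrite negb_or !(same_sym s _ e).
  by case/andP=> _ ->; rewrite !andbT; apply/imsetP; exists e.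
rewrite circlesE => /andP[/andP[/imsetP[e _ ->]]]; rewrite !eq_circle_of => nea neb.
have ne : ~~ near s k e by rewrite /near negb_or !(same_sym s _ e) nea.
have E : circle_of s e = circle_of t e.
  by apply/setP=> f; rewrite !inE tE (negPf ne) orbF.
by rewrite circle_plus_of // E circle_plus_of // ll'.
Qed.

Lemma weight_on s k : s k = false -> weight (on s k) = (weight s).+1.
Proof.
move=> sk; rewrite /weight (cardD1 k) inE on_id add1n; congr _.+1.
by apply: eq_card => m; rewrite !inE ffunE; case: (m =P k) => [->|].
Qed.

Lemma edge_coef_on k s s' l l' : edge_coef k (s, l) (s', l') -> s k = false /\ s' = on s k.
Proof.
rewrite /edge_coef; case: (link_cross k) => [[[x1 x2] x3] x4] /and4P[/negbTE sk /eqP -> _ _].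
by split.
Qed.

(** Multiplication and comultiplication both lower the sum of the circle signs by one, and the
    growth of the weight makes up for it. *)
Lemma edge_coef_qdeg k s s' l l' : valid (s, l) -> valid (s', l') ->
  edge_coef k (s, l) (s', l') -> qdeg (s', l') = qdeg (s, l).
Proof.
move=> vl vl' h; have [sk sE] := edge_coef_on h; rewrite {}sE in vl' h *.
move: h; rewrite edge_coefE // => /andP[/forallP h].
suff E : circle_sum (on s k) l' = circle_sum s l - 1 -> qdeg (on s k, l') = qdeg (s, l).
  case: (boolP (splits s k)) => [sp|nsp] hm; apply: E.
    have nE e : near s k e = near (on s k) k e.
      have sE := same_on_split Dpl sk sp; rewrite /near -(same_eqr e sp) orbb sE.
      by rewrite /near same_refl /=; case: (same_circle _ (arc1 k) e).
    have := circle_sum_merge (same_on_split Dpl sk sp) _ vl' vl.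
    rewrite splits_on // sp /= => /(_ isT) E.
    have {}E : circle_sum (on s k) l' - circle_sign (l' (arc1 k)) - circle_sign (l' (arc3 k)) =
      circle_sum s l - circle_sign (l (arc1 k)).
      by apply: E => e ne; move: (h e); rewrite nE (negPf ne) => /eqP.
    move: E hm; rewrite /circle_sign /comult_coef; clear.
    by case: (l (arc1 k)); case: (l' (arc1 k)); case: (l' (arc3 k)) => //= E _; lia.
  have := circle_sum_merge (same_on_merge Dpl sk nsp) nsp vl vl'.
  have {}h e : ~~ near s k e -> l e = l' e.
    by move=> ne; move: (h e); rewrite (negPf ne) => /eqP.
  move=> /(_ h) E.
  move: E hm; rewrite /circle_sign /mult_coef; clear.
  by case: (l (arc1 k)); case: (l (arc3 k)); case: (l' (arc1 k)) => //= E _; lia.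
rewrite /qdeg /= weight_on // -/(circle_sum (on s k) l') -/(circle_sum s l) => ->.
lia.
Qed.


(** Continuation by 0 off the bidegree makes a graded chain an ungraded function, to which exactness
    of subcubes applies. *)
Definition extend i j (x : chain D i j) : state D -> label -> int :=
  fun s l => if insub (s, l) : option (basis D i j) is Some T then x T else 0.

Definition restrict i j X : chain D i j := [ffun S => X (val S).1 (val S).2].

Lemma extendE i j (x : chain D i j) (S : basis D i j) :
  extend x (val S).1 (val S).2 = x S.
Proof. by rewrite /extend -surjective_pairing valK. Qed.

Lemma extend_out i j (x : chain D i j) s l :
  ~~ [&& valid (s, l), hdeg (s, l) == i & qdeg (s, l) == j] -> extend x s l = 0.
Proof. by move=> h; rewrite /extend insubN. Qed.

Lemma extend0 i j s l : extend (0 : chain D i j) s l = 0.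
Proof. by rewrite /extend; case: insub => // S; rewrite ffunE. Qed.

Lemma cube_diffE X s' l' : cube_diff setT X s' l' = \sum_(k | s' k)
  edge_sign k (off s' k) *
    (\sum_(l | valid (off s' k, l) && edge_coef k (off s' k, l) (s', l')) X (off s' k) l).
Proof.
rewrite /cube_diff; apply: eq_big => [k|k /andP[_ sk]]; first by rewrite inE.
by rewrite /edge_map offK.
Qed.

Lemma diffE i i' j (x : chain D i j) (S' : basis D i' j) :
  diff i' x S' = cube_diff setT (extend x) (val S').1 (val S').2.
Proof.
rewrite ffunE cube_diffE; move: (val S') => [s' l'] /=.
transitivity (\sum_S diff_coef S (s', l') * extend x S.1 S.2).
  rewrite [RHS](bigID [pred S | [&& valid S, hdeg S == i & qdeg S == j]]) /=.
  rewrite [X in _ = _ + X]big1 ?addr0; last first.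
    by move=> [s l] h; rewrite extend_out ?mulr0.
  rewrite (reindex_omap (val : basis D i j -> _) insub) /=; last first.
    by move=> S h; rewrite insubT.
  apply: eq_big => [S|S _]; first by rewrite valK eqxx andbT; case: S.
  by rewrite extendE.
transitivity (\sum_S \sum_(k | edge_coef k S (s', l')) edge_sign k S.1 * extend x S.1 S.2).
  by apply: eq_bigr => S _; rewrite mulr_suml.
rewrite (exchange_big_dep xpredT) //= [RHS]big_mkcond /=; apply: eq_bigr => k _.
transitivity (\sum_s \sum_(l | edge_coef k (s, l) (s', l')) edge_sign k s * extend x s l).
  by rewrite pair_big_dep; apply: eq_big => [[s l]|[s l]].
rewrite (bigD1 (off s' k)) //= [X in _ + X]big1 ?addr0; last first.
  move=> s ns; rewrite big_pred0 // => l; apply/negP=> /edge_coef_on[sk s'E].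
  by rewrite s'E onK // eqxx in ns.
case: ifP => s'k; last first.
  rewrite big_pred0 // => l; apply/negP=> /edge_coef_on[_ s'E].
  by rewrite s'E on_id in s'k.
rewrite big_distrr /= big_mkcondl /= [RHS]big_mkcond /= [LHS]big_mkcond /=.
apply: eq_bigr => l _; case: (edge_coef _ _ _) => //=; rewrite ?if_same //.
by case: ifP => // /negbT vl; rewrite extend_out ?mulr0 // (negPf vl).
Qed.

Lemma hdeg_on k s l l' : s k = false -> hdeg (on s k, l') = hdeg (s, l) + 1.
Proof. by move=> sk; rewrite /hdeg /= weight_on //; lia. Qed.

(** This includes labels outside the target bidegree: there the edge maps only reach labels outside
    the source bidegree, and both sides are 0. *)
Lemma extend_diff i i' j (x : chain D i j) s l : i' = i + 1 -> valid (s, l) ->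
  cube_diff setT (extend x) s l = extend (diff i' x) s l.
Proof.
move=> iE vl; rewrite [RHS]/extend; case: insubP => [S _ SE|h].
  by rewrite diffE SE.
rewrite cube_diffE big1 // => k sk; rewrite big1 ?mulr0 // => l0 /andP[vl0 h0].
apply: extend_out; apply: contra h => /and3P[_ /eqP hs /eqP qs].
rewrite vl (edge_coef_qdeg vl0 vl h0) qs eqxx andbT /=.
by rewrite -(offK sk) (hdeg_on l0) ?off_id // hs iE.
Qed.

Lemma diff_restrict i i' j X (S' : basis D i' j) : i' = i + 1 ->
  diff i' (restrict i j X) S' = cube_diff setT X (val S').1 (val S').2.
Proof.
move=> iE; rewrite diffE; case: S' => [[s' l'] /= /and3P[vl' /eqP hs' /eqP qs']].
rewrite !cube_diffE; apply: eq_bigr => k sk; congr (_ * _).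
apply: eq_bigr => l /andP[vl h].
rewrite /extend; case: insubP => [S _ SE|]; first by rewrite ffunE SE.
rewrite vl -(edge_coef_qdeg vl vl' h) qs' eqxx andbT /= => /eqP[].
move: hs'; rewrite -{1}(offK sk) (hdeg_on l) ?off_id // iE => hE.
exact: addIr hE.
Qed.

Lemma cube_weightT s : cube_weight setT s = weight s.
Proof. by apply: eq_card => k; rewrite !inE. Qed.

Lemma in_cubeT s0 s : in_cube setT s0 s.
Proof. by move=> m; rewrite inE. Qed.

End Grading.

(** * Criteria for homology to vanish or to be infinite cyclic *)

Section HomologyFacts.
Variables (A B C : zmodType) (f : {additive A -> B}) (g : {additive B -> C}).

Definition homology_class (z : cycles g) : homology f g := (\pi_(homology f g) z)%qT.

Lemma homology_classP (x : homology f g) : exists z, x = homology_class z.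
Proof. by elim/quotP: x => z _; exists z. Qed.

Lemma homology_classB z z' :
  homology_class (z - z') = homology_class z - homology_class z'.
Proof. exact: raddfB. Qed.

Lemma homology_class_eq0 z : homology_class z = 0 <-> exists a, f a = val z.
Proof.
rewrite -[0](_ : homology_class 0 = 0); last exact: raddf0.
have E : (z - 0 \in boundary_pred f (g := g)) = (homology_class z == homology_class 0).
  exact: Quotient.idealrBE.
rewrite subr0 in E; split=> [/eqP|h]; first by rewrite -E => /asboolP.
by apply/eqP; rewrite -E; apply/asboolP.
Qed.

Lemma homology_eq0 : (forall b, g b = 0 -> exists a, f a = b) ->
  forall x : homology f g, x = 0.
Proof.
move=> ex x; have [[b gb] ->] := homology_classP x.
by apply/homology_class_eq0/ex/eqP.
Qed.

(** The map [n |-> n [z0]] is additive and bijective; the isomorphism onto the integers is its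
    inverse, obtained by choice. *)
Lemma homology_int z0 : g z0 = 0 ->
  (forall b, g b = 0 -> exists a n, b = z0 *~ n + f a) ->
  (forall a n, z0 *~ n = f a -> n = 0) -> zmod_iso (homology f g) int.
Proof.
move=> gz0 gen free.
have cz0 : z0 \in cycle_pred g by apply/eqP.
pose phi (n : int) := homology_class (Cycle cz0 *~ n).
have phiB m n : phi (m - n) = phi m - phi n by rewrite /phi mulrzBr homology_classB.
have valz n : val (Cycle cz0 *~ n) = z0 *~ n by exact: raddfMz.
have inj m n : phi m = phi n -> m = n.
  move/eqP; rewrite -subr_eq0 -phiB => /eqP/homology_class_eq0[a fa].
  by apply/eqP; rewrite -subr_eq0; apply/eqP/(free a); rewrite fa; exact/esym/valz.
have surj x : exists n, phi n == x.
  have [[b gb] ->] := homology_classP x.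
  have [a [n bE]] := gen b (eqP gb).
  exists n; rewrite -subr_eq0 -homology_classB; apply/eqP/homology_class_eq0.
  exists (- a); transitivity (z0 *~ n - b); first by rewrite bE raddfN opprD addrA subrr add0r.
  by rewrite -(valz n); exact/esym/(raddfB (val : cycles g -> B)).
pose psi x := xchoose (surj x).
have phiK x : phi (psi x) = x by apply/eqP; exact: (xchooseP (surj x)).
have psiB : zmod_morphism psi.
  by move=> x y; apply: inj; rewrite phiB !phiK.
pose Psi : {additive homology f g -> int} :=
  HB.pack psi (GRing.isZmodMorphism.Build _ _ psi psiB).
exists Psi; exists phi => [x|n]; first exact: phiK.
by apply: inj; rewrite phiK.
Qed.

End HomologyFacts.

(** * States of a braid closure *)

Section BraidStates.
Variables (m : nat) (w : braid_word m).
Local Notation Dw := (braid_closure w).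
Local Notation crossing := 'I_(size w).
Local Notation edge := (closure_edge w).
Implicit Types (s : state Dw) (k : crossing) (e f : edge) (p : 'I_m.+1).

Definition letter k := tnth (in_tuple w) k.
Definition left k : 'I_m.+1 := widen_ord (leqnSn m) (letter k).1.
Definition right k : 'I_m.+1 := lift ord0 (letter k).1.
Definition bot k p : edge := (widen_ord (leqnSn (size w)) k, p).
Definition top k p : edge := (lift ord0 k, p).

(** At a crossing which is not vertical, the two strands below are joined by a
    cap and the two strands above by a cup. *)
Definition vertical s k := s k != (letter k).2.

Variant edge_step s : edge -> edge -> Prop :=
| StepWrap p : edge_step s (ord_max, p) (ord0, p)
| StepUp k p : ((p != left k) && (p != right k)) || vertical s k ->
    edge_step s (bot k p) (top k p)
| StepCap k : ~~ vertical s k -> edge_step s (bot k (left k)) (bot k (right k))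
| StepCup k : ~~ vertical s k -> edge_step s (top k (left k)) (top k (right k)).

Lemma right_val k : right k = (left k).+1 :> nat. Proof. by []. Qed.

Lemma left_neq_right k : (left k == right k) = false.
Proof. by apply/eqP=> /(congr1 (@nat_of_ord _)); rewrite right_val => /n_Sn. Qed.

Lemma link_crossE k : link_cross (l := Dw) k =
  if (letter k).2 then (bot k (right k), top k (right k), top k (left k), bot k (left k))
  else (bot k (left k), bot k (right k), top k (right k), top k (left k)).
Proof. by []. Qed.

Lemma arc1E k : arc1 (D := Dw) k = bot k (if (letter k).2 then right k else left k).
Proof. by rewrite /arc1 link_crossE; case: (letter k).2. Qed.

Lemma arc3E k : arc3 (D := Dw) k = top k (if (letter k).2 then left k else right k).
Proof. by rewrite /arc3 link_crossE; case: (letter k).2. Qed.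

Lemma link_joinP e f : link_join (l := Dw) e f ->
  (exists p, e = (ord_max, p) /\ f = (ord0, p)) \/
  (exists k p, [/\ e = bot k p, f = top k p, p != left k & p != right k]).
Proof.
case: e f => [t p] [t' p'] /= /andP[/eqP /= -> /orP[/andP[/eqP /= -> /eqP /= ->]|]].
  by left; exists p'.
case/existsP=> k /and4P[/eqP /= tk /eqP /= t'k pl pr]; right; exists k, p'; split=> //.
  by congr (_, _); apply: val_inj.
by congr (_, _); apply: val_inj.
Qed.

Lemma smoothingE s k e f : smoothing (D := Dw) (s k) k e f =
  if vertical s k
  then ((e, f) == (bot k (right k), top k (right k))) ||
       ((e, f) == if (letter k).2 then (top k (left k), bot k (left k))
                  else (bot k (left k), top k (left k)))
  else ((e, f) == if (letter k).2 then (bot k (right k), bot k (left k))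
                  else (bot k (left k), bot k (right k))) ||
       ((e, f) == (top k (right k), top k (left k))).
Proof.
rewrite /smoothing link_crossE /vertical.
by case: (s k); case: (letter k).2 => //=; rewrite orbC.
Qed.

Lemma adjacent_step s e f : adjacent (D := Dw) s e f -> edge_step s e f \/ edge_step s f e.
Proof.
have H e' f' : link_join (l := Dw) e' f' || [exists k, smoothing (D := Dw) (s k) k e' f'] ->
    edge_step s e' f' \/ edge_step s f' e'.
  case/orP=> [/link_joinP[[p [-> ->]]|[k [p [-> -> pl pr]]]]|/existsP[k]].
  - by left; apply: StepWrap.
  - by left; apply: StepUp; rewrite pl pr.
  rewrite smoothingE; case: (boolP (vertical s k)) => vk.
    case/orP=> [/eqP[-> ->]|]; first by left; apply: StepUp; rewrite vk orbT.
    case: (letter k).2 => /eqP[-> ->]; [right | left];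
      by apply: StepUp; rewrite vk orbT.
  case/orP; last by move=> /eqP[-> ->]; right; apply: StepCup.
  by case: (letter k).2 => /eqP[-> ->]; [right | left]; apply: StepCap.
by rewrite /adjacent => /orP[] /H []; [left | right | right | left].
Qed.

Lemma step_same s e f : edge_step s e f -> same_circle (D := Dw) s e f.
Proof.
have smooth k e' f' : smoothing (D := Dw) (s k) k e' f' -> same_circle (D := Dw) s e' f'.
  by move=> h; apply/connect1/adjacent_smoothing/h.
have join e' f' : link_join (l := Dw) e' f' -> same_circle (D := Dw) s e' f'.
  by move=> h; apply: connect1; rewrite /adjacent h.
case=> [p|k p h|k h|k h].
- by apply: join; rewrite /= /closure_join /= !eqxx.
- case: (boolP ((p != left k) && (p != right k))) h => [/andP[pl pr] _|ph /= vk].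
    apply: join; rewrite /= /closure_join /= eqxx /=; apply/orP; right.
    by apply/existsP; exists k; rewrite /= !eqxx pl pr.
  move: ph; rewrite negb_and !negbK => /orP[] /eqP ->.
    case lk: (letter k).2; last by apply: (smooth k); rewrite smoothingE vk lk eqxx orbT.
    rewrite same_sym; apply: (smooth k).
    by rewrite smoothingE vk lk eqxx orbT.
  by apply: (smooth k); rewrite smoothingE vk eqxx.
- case lk: (letter k).2.
    by rewrite same_sym; apply: (smooth k); rewrite smoothingE (negPf h) lk eqxx.
  by apply: (smooth k); rewrite smoothingE (negPf h) lk eqxx.
- by rewrite same_sym; apply: (smooth k); rewrite smoothingE (negPf h) eqxx orbT.
Qed.

Lemma same_closed s (R : rel edge) : reflexive R -> symmetric R -> transitive R ->
  (forall e f, edge_step s e f -> R e f) ->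
  forall e f, same_circle (D := Dw) s e f -> R e f.
Proof.
move=> Rr Rs Rt Rstep; apply: (@same_sub Dw s R) => // e f /adjacent_step[|] /Rstep //.
by rewrite Rs.
Qed.

Lemma same_invariant s (T : eqType) (h : edge -> T) :
  (forall e f, edge_step s e f -> h e = h f) ->
  forall e f, same_circle (D := Dw) s e f -> h e = h f.
Proof.
move=> hs e f ef; apply/eqP; move: e f ef.
apply: (@same_closed s (fun e f => h e == h f)).
- by move=> e /=.
- by move=> e f /=; rewrite eq_sym.
- by move=> e f g /= /eqP ->.
- by move=> e f /= /hs ->.
Qed.

(** Orient the edges in even positions upwards and those in odd positions
    downwards: every state then becomes a union of oriented circles, that is, a
    permutation of the edges, and changing the smoothing of [k] multiplies it by
    the transposition of [arc_up k] and [arc_down k]. *)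
Definition arc_up k : edge := bot k (if odd (left k) then right k else left k).
Definition arc_down k : edge := top k (if odd (left k) then left k else right k).

Lemma arc_up_odd k : odd (arc_up k).2 = false.
Proof. by rewrite /arc_up /=; case: ifP => //; rewrite right_val /= => ->. Qed.

Lemma arc_down_odd k : odd (arc_down k).2.
Proof. by rewrite /arc_down /=; case: ifP => //; rewrite right_val /= => ->. Qed.

Lemma arc_up_inj : injective arc_up.
Proof. by move=> k k' /(congr1 (fun e => nat_of_ord e.1)) /= h; apply: val_inj. Qed.

Lemma arc_down_inj : injective arc_down.
Proof.
move=> k k' /(congr1 (fun e => nat_of_ord e.1)) /=; rewrite /bump !add1n => -[h].
exact: val_inj.
Qed.

Lemma arc_up_neq_down k k' : arc_up k <> arc_down k'.
Proof. by move=> h; have := arc_down_odd k'; rewrite -h arc_up_odd. Qed.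

(** At a cap and cup the bottom edge in even position is exchanged with the top edge in odd
    position; the vertical motion of [rotate] then lands on the other end of the cap or the cup. The
    state thus enters through an involution alone. *)
Definition turn s e : edge :=
  if [pick k | ~~ vertical s k && (e == arc_up k)] is Some k then arc_down k
  else if [pick k | ~~ vertical s k && (e == arc_down k)] is Some k then arc_up k
  else e.

Lemma turn_up s k : turn s (arc_up k) = if vertical s k then arc_up k else arc_down k.
Proof.
rewrite /turn; case: pickP => [k' /andP[vk' /eqP/arc_up_inj kk']|h].
  by rewrite kk' (negPf vk').
case: pickP => [k' /andP[_ /eqP/arc_up_neq_down //]|_].
by have := h k; rewrite eqxx andbT => /negbFE ->.
Qed.

Lemma turn_down s k : turn s (arc_down k) = if vertical s k then arc_down k else arc_up k.
Proof.
rewrite /turn; case: pickP => [k' /andP[_ /eqP/esym/arc_up_neq_down //]|_].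
case: pickP => [k' /andP[vk' /eqP/arc_down_inj kk']|h].
  by rewrite kk' (negPf vk').
by have := h k; rewrite eqxx andbT => /negbFE ->.
Qed.

Lemma turn_id s e : (forall k, vertical s k = false -> e != arc_up k /\ e != arc_down k) ->
  turn s e = e.
Proof.
move=> h; rewrite /turn; case: pickP => [k /andP[/negbTE/h[/negPf ne _]]|_].
  by rewrite ne.
by case: pickP => [k /andP[/negbTE/h[_ /negPf ne]]|//]; rewrite ne.
Qed.

Variant turn_spec s e : edge -> Prop :=
| TurnUp k of ~~ vertical s k & e = arc_up k : turn_spec s e (arc_down k)
| TurnDown k of ~~ vertical s k & e = arc_down k : turn_spec s e (arc_up k)
| TurnId of (forall k, vertical s k = false -> e != arc_up k /\ e != arc_down k) :
    turn_spec s e e.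

Lemma turnP s e : turn_spec s e (turn s e).
Proof.
rewrite /turn; case: pickP => [k /andP[vk /eqP ->]|h1]; first exact: TurnUp.
case: pickP => [k /andP[vk /eqP ->]|h2]; first exact: TurnDown.
by apply: TurnId => k vk; have := h1 k; have := h2 k; rewrite vk /= => -> ->.
Qed.

Lemma turnK s : involutive (turn s).
Proof.
move=> e; case: (turnP s e) => [k vk ->|k vk ->|/turn_id //].
  by rewrite turn_down (negPf vk).
by rewrite turn_up (negPf vk).
Qed.

Definition rotate e : edge := (if odd e.2 then ord_pred e.1 else ordS e.1, e.2).

Lemma rotate_inj : injective rotate.
Proof.
move=> [t p] [t' p'] h; have pp := congr1 snd h; have {h} := congr1 fst h.
move: pp => /= ->; case: ifP => _ h; congr (_, _).
  exact: (can_inj (@ord_predK _)) h.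
exact: (can_inj (@ordSK _)) h.
Qed.

Definition next s e := rotate (turn s e).

Lemma next_inj s : injective (next s).
Proof. exact: inj_comp rotate_inj (can_inj (turnK s)). Qed.

Definition circle_perm s : {perm edge} := perm (@next_inj s).

Lemma ord_pred_top k p : (ord_pred (top k p).1, p) = bot k p.
Proof.
congr (_, _); apply: val_inj => /=.
by rewrite add0n modnDr modn_small // ltnW // ltnS.
Qed.

Lemma ordS_bot k p : (ordS (bot k p).1, p) = top k p.
Proof. by congr (_, _); apply: val_inj => /=; rewrite modn_small // ltnS. Qed.

Lemma same_next s e : same_circle (D := Dw) s e (next s e).
Proof.
rewrite /next; case: turnP => [k vk ->|k vk ->|h].
- rewrite /rotate arc_down_odd ord_pred_top /arc_up.
  case: ifP => _; last exact/step_same/StepCap.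
  by rewrite same_sym; apply/step_same/StepCap.
- rewrite /rotate arc_up_odd ordS_bot /arc_down.
  case: ifP => _; first exact/step_same/StepCup.
  by rewrite same_sym; apply/step_same/StepCup.
case: e h => t p h; rewrite /rotate /=; case: ifP => op.
  have [t0|tpos] := posnP t.
    rewrite same_sym (_ : ord_pred t = ord_max); last first.
      by apply: val_inj; rewrite /= t0 add0n /= modn_small.
    rewrite (_ : t = ord0); last exact: val_inj.
    exact/step_same/StepWrap.
  have kt : (t.-1 < size w)%N by rewrite -ltnS prednK.
  pose k : crossing := Ordinal kt.
  have tE : t = (top k p).1 by apply: val_inj; rewrite /= /bump add1n prednK.
  rewrite tE ord_pred_top same_sym; apply/step_same/(@StepUp s k p).
  case: (boolP (vertical s k)) => [|/negbTE/h[_ ne]]; first by rewrite orbT.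
  rewrite orbF; apply/andP; split; apply: contraNneq ne => pE; apply/eqP;
    rewrite /arc_down {1}tE pE; congr (_, _).
    by rewrite -pE op.
  by move: op; rewrite pE right_val /= => /negbTE ->.
have [tN|tN] := eqVneq t ord_max.
  rewrite tN (_ : ordS ord_max = ord0); first exact/step_same/StepWrap.
  by apply: val_inj; rewrite /= modnn.
have kt : (t < size w)%N by rewrite ltn_neqAle -ltnS ltn_ord andbT; exact: tN.
pose k : crossing := Ordinal kt.
have tE : t = (bot k p).1 by apply: val_inj.
rewrite tE ordS_bot; apply/step_same/(@StepUp s k p).
case: (boolP (vertical s k)) => [|/negbTE/h[ne _]]; first by rewrite orbT.
rewrite orbF; apply/andP; split; apply: contraNneq ne => pE; apply/eqP;
  rewrite /arc_up {1}tE pE; congr (_, _).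
  by rewrite -pE op.
by move: op; rewrite pE right_val /= => /negbFE ->.
Qed.

Lemma bot_arc_up k k' p : bot k p = arc_up k' -> k' = k /\ (p == left k) || (p == right k).
Proof.
move=> h; have kk : k' = k.
  by apply: val_inj; have := congr1 (fun e => nat_of_ord e.1) h.
have := congr1 snd h; rewrite kk /= => ->.
by split=> //; case: ifP; rewrite eqxx ?orbT.
Qed.

Lemma top_arc_down k k' p : top k p = arc_down k' -> k' = k /\ (p == left k) || (p == right k).
Proof.
move=> h; have kk : k' = k.
  apply: val_inj; have := congr1 (fun e => nat_of_ord e.1) h.
  by rewrite /= /bump !add1n => -[].
have := congr1 snd h; rewrite kk /= => ->.
by split=> //; case: ifP; rewrite eqxx ?orbT.
Qed.

(** Neighbouring positions have opposite orientations, so caps and cups are traversed consistently;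
    the parity of a position decides the direction. *)
Lemma step_next s e f : edge_step s e f -> f = next s e \/ e = next s f.
Proof.
case=> [p|k p h|k h|k h].
- case op: (odd p); [right | left]; rewrite /next turn_id.
  + by rewrite /rotate [odd _]op; congr (_, _); apply: val_inj; rewrite /= modn_small.
  + move=> k _; split; apply/eqP => pE; first by have := arc_up_odd k; rewrite -pE /= op.
    by have := congr1 (fun e => nat_of_ord e.1) pE.
  + by rewrite /rotate [odd _]op; congr (_, _); apply: val_inj; rewrite /= modnn.
  + move=> k _; split; apply/eqP => pE; last by have := arc_down_odd k; rewrite -pE /= op.
    have := congr1 (fun e => nat_of_ord e.1) pE => /= kN.
    by have := ltn_ord k; rewrite -kN ltnn.
- have nh k' : vertical s k' = false -> k' = k -> (p == left k) || (p == right k) -> False.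
    move=> vk kk; rewrite kk in vk; move: h; rewrite vk orbF.
    by case: (p == left k); case: (p == right k).
  case op: (odd p); [right | left]; rewrite /next turn_id.
  + by rewrite /rotate [odd _]op ord_pred_top.
  + move=> k' vk; split; apply/eqP => pE; first by have := arc_up_odd k'; rewrite -pE /= op.
    by have [kk ab] := top_arc_down pE; exact: nh vk kk ab.
  + by rewrite /rotate [odd _]op ordS_bot.
  + move=> k' vk; split; apply/eqP => pE; last by have := arc_down_odd k'; rewrite -pE /= op.
    by have [kk ab] := bot_arc_up pE; exact: nh vk kk ab.
- have : next s (arc_up k) = bot k (arc_down k).2.
    by rewrite /next turn_up (negPf h) /rotate arc_down_odd ord_pred_top.
  by rewrite /arc_up /arc_down; case: ifP => _ <-; [right | left].
have : next s (arc_down k) = top k (arc_up k).2.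
  by rewrite /next turn_down (negPf h) /rotate arc_up_odd ordS_bot.
by rewrite /arc_up /arc_down; case: ifP => _ <-; [left | right].
Qed.

Lemma porbit_same s e f : (f \in porbit (circle_perm s) e) = same_circle (D := Dw) s e f.
Proof.
apply/idP/idP=> [/porbitP[i ->]|].
  elim: i => [|i IH]; first by rewrite expg0 perm1; exact: same_refl.
  by rewrite expgSr permM permE; apply: same_trans IH _; exact: same_next.
apply: (@same_closed s (fun e f => f \in porbit (circle_perm s) e)) => {e f}.
- by move=> e /=; exact: porbit_id.
- by move=> e f /=; rewrite porbit_sym.
- by move=> e f g /=; rewrite -!eq_porbit_mem => /eqP -> /eqP ->.
- have nx e : next s e \in porbit (circle_perm s) e.
    by have := mem_porbit (circle_perm s) 1 e; rewrite expg1 permE.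
  by move=> e f /step_next [] ->; [|rewrite porbit_sym]; exact: nx.
Qed.

Lemma circle_perm_on s k : s k = false ->
  circle_perm (on (D := Dw) s k) = (tperm (arc_up k) (arc_down k) * circle_perm s)%g.
Proof.
move=> sk; apply/permP=> e; rewrite permM [LHS]permE [RHS]permE /next; congr rotate.
have vk : vertical (on (D := Dw) s k) k = ~~ vertical s k.
  by rewrite /vertical on_id sk; case: (letter k).2.
have v' k' : k' != k -> vertical (on (D := Dw) s k) k' = vertical s k'.
  by move=> kk; rewrite /vertical on_neq.
case: (tpermP (arc_up k) (arc_down k) e) => [->|->|/eqP n1 /eqP n2].
- by rewrite turn_up turn_down vk; case: (vertical s k).
- by rewrite turn_up turn_down vk; case: (vertical s k).
case: (turnP s e) => [k1 vk1 eE|k1 vk1 eE|h].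
- have kk : k1 != k by apply: contraNneq n1 => <-; rewrite eE.
  by rewrite eE turn_up v' // (negPf vk1).
- have kk : k1 != k by apply: contraNneq n2 => <-; rewrite eE.
  by rewrite eE turn_down v' // (negPf vk1).
by apply: turn_id => k1; have [->//|kk] := eqVneq k1 k; rewrite v' //; exact: h.
Qed.

(** The two pairs may be different diagonals of the crossing. In either smoothing the ends of one
    diagonal are joined to those of the other, so the diagonals are equivalent. *)
Lemma splits_arcs s k : splits (D := Dw) s k = same_circle (D := Dw) s (arc_up k) (arc_down k).
Proof.
rewrite /splits arc1E arc3E /arc_up /arc_down.
have E : same_circle (D := Dw) s (bot k (left k)) (top k (right k)) =
         same_circle (D := Dw) s (bot k (right k)) (top k (left k)).
  case: (boolP (vertical s k)) => vk.
    have h1 : same_circle (D := Dw) s (bot k (left k)) (top k (left k)).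
      by apply/step_same/StepUp; rewrite vk orbT.
    have h2 : same_circle (D := Dw) s (bot k (right k)) (top k (right k)).
      by apply/step_same/StepUp; rewrite vk orbT.
    by rewrite (same_eqr _ h1) (same_eqr _ h2) same_sym.
  have h1 := step_same (StepCap vk); have h2 := step_same (StepCup vk).
  by rewrite (same_eqr _ h1) same_sym -(same_eqr _ h2) same_sym.
by case: (letter k).2; case: (odd (left k)); rewrite ?E.
Qed.

(** Multiplying a permutation by a transposition splits the cycle containing both points or merges
    their two cycles, which is what [planar] asks of the circles. *)
Lemma braid_closure_planar : planar Dw.
Proof.
exists (fun s => (#|porbits (circle_perm s)|)%:Z) => s k sk.
rewrite !splits_arcs -!porbit_same ![_ \in porbit _ (arc_up k)]porbit_sym.
set t := tperm (arc_up k) (arc_down k).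
have ne : arc_up k != arc_down k by apply/eqP/arc_up_neq_down.
have E : circle_perm s = (t * circle_perm (on (D := Dw) s k))%g.
  by rewrite circle_perm_on // mulgA tperm2 mul1g.
have := porbits_mul_tperm (circle_perm s) (arc_up k) (arc_down k).
have := porbits_mul_tperm (circle_perm (on (D := Dw) s k)) (arc_up k) (arc_down k).
rewrite /= -/t ne -E -(circle_perm_on sk).
by case: (_ \in _); case: (_ \in _) => /=; split=> //; lia.
Qed.

End BraidStates.

(** * Kinks in a braid closure *)

Section BraidExactness.
Variables (m : nat) (w : braid_word m).
Local Notation Dw := (braid_closure w).
Local Notation crossing := 'I_(size w).
Local Notation edge := (closure_edge w).
Local Notation same := (same_circle (D := Dw)).
Local Notation splits := (splits (D := Dw)).
Local Notation on := (on (D := Dw)).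
Local Notation exact_at := (exact_at (D := Dw)).
Implicit Types (s : state Dw) (i j k : crossing) (e f : edge) (p : 'I_m.+1).
Implicit Types (U : {set crossing}).
Let pl := braid_closure_planar w.

Lemma vertical_path s (t u : 'I_(size w).+1) p : (t <= u)%N ->
  (forall k, (t <= k < u)%N -> ((p != left k) && (p != right k)) || vertical s k) ->
  same s (t, p) (u, p).
Proof.
case: u => u hu /=; elim: u hu => [|u IH] hu tu h.
  rewrite (_ : t = Ordinal hu); first exact: same_refl.
  by apply: val_inj; apply/eqP; rewrite /= -leqn0.
move: tu; rewrite leq_eqVlt => /orP[/eqP tu|tu].
  rewrite (_ : t = Ordinal hu); first exact: same_refl.
  exact: val_inj.
have hu' : (u < (size w).+1)%N by apply: ltnW.
apply: (@same_trans Dw s (Ordinal hu', p)).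
  by apply: IH => // k /andP[tk ku]; apply: h; rewrite tk /= ltnW.
have -> : (Ordinal hu', p) = bot (Ordinal (hu : u < size w)%N) p.
  by congr (_, _); apply: val_inj.
have -> : (Ordinal hu, p) = top (Ordinal (hu : u < size w)%N) p.
  by congr (_, _); apply: val_inj.
by apply/step_same/StepUp/h; rewrite /= leqnn andbT.
Qed.

Lemma splits_top s k : vertical s k -> same s (top k (left k)) (top k (right k)) -> splits s k.
Proof.
move=> vk h; have up p : same s (bot k p) (top k p).
  by apply/step_same/StepUp; rewrite vk orbT.
rewrite /splits arc1E arc3E; apply: same_trans (up _) _.
by case: ifP => _ //; rewrite same_sym.
Qed.

Lemma left_right i j : left i = left j -> right i = right j.
Proof. by move=> h; apply: val_inj; rewrite [LHS]right_val [RHS]right_val h. Qed.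

Lemma between_path s i j p : (i < j)%N ->
  (forall k, (i < k < j)%N -> vertical s k) -> same s (top i p) (bot j p).
Proof.
move=> ij h; apply: vertical_path => /= [|k]; rewrite /bump add1n //.
by move=> /h ->; rewrite orbT.
Qed.

(** The cap of [j] joins the two strands leaving [i], so [i] meets only one circle. In the mirror
    image [splits_above] the cup of the lower letter joins them. *)
Lemma splits_below s i j : (i < j)%N -> left i = left j -> vertical s i ->
  ~~ vertical s j -> (forall k, (i < k < j)%N -> vertical s k) -> splits s i.
Proof.
move=> ij lij vi vj h; apply: splits_top => //.
apply: same_trans (between_path _ ij h) _; rewrite same_sym.
apply: same_trans (between_path _ ij h) _; rewrite same_sym.
by rewrite (left_right lij) lij; apply/step_same/StepCap.
Qed.

Lemma splits_above s i j : (i < j)%N -> left i = left j -> ~~ vertical s i ->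
  vertical s j -> (forall k, (i < k < j)%N -> vertical s k) -> splits s j.
Proof.
move=> ij lij vi vj h; apply: splits_top => //.
have up p : same s (bot j p) (top j p).
  by apply/step_same/StepUp; rewrite vj orbT.
have P p : same s (top i p) (top j p) by apply: same_trans (between_path _ ij h) (up p).
rewrite -(left_right lij) -lij; rewrite same_sym; apply: (@same_trans Dw s (top i (right i))).
  by rewrite same_sym.
rewrite same_sym; apply: same_trans (step_same (StepCup vi)).
by rewrite same_sym.
Qed.

(** Once [j] is smoothed, the cup of [i] and the cap of [j] close up to a small circle that never
    leaves the levels between them. *)
Lemma kink_circle s i j e : (i < j)%N -> left i = left j -> ~~ vertical s i ->
  vertical s j -> s j = false -> (forall k, (i < k < j)%N -> vertical s k) ->
  same (on s j) (arc1 (D := Dw) j) e -> (i < e.1 <= j)%N.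
Proof.
move=> ij lij vi vj sj h.
have rij := left_right lij.
(* Level [t] lies just below crossing [t]: the circle starts above [i], on level [i + 1], and ends
   below [j], on level [j]. *)
pose inP e := (i < e.1 <= j)%N && ((e.2 == left j) || (e.2 == right j)).
have oni : on s j i = s i.
  by rewrite on_neq // -val_eqE ltn_eqF.
have vj' : vertical (on s j) j = false.
  by move: vj; rewrite /vertical on_id sj; case: (letter j).2.
have vi' : vertical (on s j) i = false by rewrite /vertical oni; apply/negbTE.
have h' k : (i < k < j)%N -> vertical (on s j) k.
  move=> ikj; rewrite /vertical on_neq; first exact: h.
  by move/andP: ikj => [_ kj]; rewrite -val_eqE ltn_eqF.
have inv : forall e f, same (on s j) e f -> inP e = inP f.
  apply: same_invariant => {}e f [p|k p hk|k hk|k hk]; rewrite /inP /=.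
  - by rewrite [(size w <= j)%N]leqNgt (ltn_ord j) andbF.
  - rewrite /bump add1n ltnS.
    case: (boolP ((p == left j) || (p == right j))) => pj; rewrite ?andbF ?andbT //.
    have tch : left k = left j -> vertical (on s j) k.
      move=> lk; have rk := left_right lk; move: hk.
      by rewrite lk rk; case: (p == left j) pj; case: (p == right j).
    case: (ltngtP k i) => [ki|ki|/val_inj ki]; last by rewrite ki vi' in tch; have := tch lij.
      by rewrite leqNgt (ltn_trans ki ij).
    case: (ltngtP k j) => // /val_inj kj; rewrite kj vj' in tch; by have := tch erefl.
  - case: (boolP (i < k <= j)%N) => //= /andP[ik].
    rewrite leq_eqVlt => /orP[/eqP/val_inj ->|kj]; first by rewrite !eqxx orbT.
    by rewrite h' ?ik ?kj in hk.
  - rewrite /bump add1n ltnS; case: (boolP (i <= k < j)%N) => //= /andP[].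
    rewrite leq_eqVlt => /orP[/eqP/val_inj <- _|ik kj]; first by rewrite lij rij !eqxx orbT.
    by rewrite h' ?ik ?kj in hk.
move=> /inv; rewrite /inP arc1E /= ij leqnn /=.
by case: ifP => _; rewrite eqxx ?orbT => /esym/andP[].
Qed.

(** The letters between [i] and [j] are outside [U], so no other crossing of [U] has an arc on the
    small circle, as [exact_kink] requires. *)
Lemma exact_kink_braid U s0 n i j : j \in U -> s0 j = false -> vertical s0 j ->
  (i < j)%N -> left i = left j -> i \notin U -> ~~ vertical s0 i ->
  (forall k, (i < k < j)%N -> (k \notin U) && vertical s0 k) ->
  exact_at (U :\ j) (on s0 j) n -> exact_at U s0 n.+1.
Proof.
move=> jU s0j vj ij lij iU vi h; apply: (exact_kink pl) => // [s sU|s k sU kU].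
  have [sU' sj] := (in_cubeD1 (D := Dw) s s0j jU).1 sU.
  apply: (splits_above ij lij); rewrite /vertical ?(sU' i) ?sj -?s0j //.
  by move=> k /h /andP[kU vk]; rewrite (sU' k).
have [sU' sj] := (in_cubeD1 (D := Dw) s s0j jU).1 sU.
have H e : same (on s j) (arc1 (D := Dw) j) e -> (i < e.1 <= j)%N.
  apply: (kink_circle ij lij) => //; rewrite /vertical ?(sU' i) ?sj -?s0j //.
  by move=> k' /h /andP[kU' vk]; rewrite (sU' k').
move: kU; rewrite !inE => /andP[kj kU].
have ki : k != i by apply: contraNneq iU => <-.
have nk : ~~ (i <= k <= j)%N.
  apply/negP=> /andP[]; rewrite leq_eqVlt val_eqE eq_sym (negPf ki) /= => ik.
  rewrite leq_eqVlt val_eqE (negPf kj) /= => kj'.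
  by have := h k; rewrite ik kj' kU => /(_ isT).
split; apply/negP=> /H; rewrite ?arc1E ?arc3E /=.
  by move=> /andP[ik kj']; rewrite (ltnW ik) kj' in nk.
by rewrite /bump add1n ltnS => /andP[ik kj']; rewrite ik (ltnW kj') in nk.
Qed.

End BraidExactness.

(** * The cube of the cap-cup smoothing *)

(** The last of the [2n + 1] blocks with the five final letters. The block supplies one letter for
    each generator and the sigma1 below the negative letter. *)
Definition beta_tail : braid_word 3 :=
  [:: sigma2; sigma1; sigma3; sigma2; sigma1_inv; sigma2; sigma1; sigma1; sigma2].

Section Tail.
Variable pre : braid_word 3.
Hypothesis pre_pos : all snd pre.
Local Notation w := (pre ++ beta_tail).
Local Notation Dw := (braid_closure w).
Local Notation crossing := 'I_(size w).
Local Notation on := (on (D := Dw)).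
Local Notation exact_at := (exact_at (D := Dw)).
Implicit Types (s : state Dw) (k : crossing) (U : {set crossing}).
Let pl := braid_closure_planar w.

Fact tail_subproof i : (i < 9)%N -> (size pre + i < size w)%N.
Proof. by rewrite size_cat ltn_add2l. Qed.

Definition tail_crossing i (hi : (i < 9)%N) : crossing := Ordinal (tail_subproof hi).
Local Notation T i := (@tail_crossing i isT).

Lemma letter_tail i (hi : (i < 9)%N) : letter (tail_crossing hi) = nth sigma2 beta_tail i.
Proof. by rewrite /letter (tnth_nth sigma2) /= nth_cat ltnNge leq_addr addKn. Qed.

Lemma tail_crossing_eq i j (hi : (i < 9)%N) (hj : (j < 9)%N) :
  (tail_crossing hi == tail_crossing hj) = (i == j).
Proof. by rewrite -val_eqE /= eqn_add2l. Qed.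

Lemma letter_positive k : (letter k).2 = (k != T 4).
Proof.
have [kp|kp] := ltnP k (size pre).
  have -> : k != T 4 by rewrite -val_eqE /= ltn_eqF // (leq_trans kp) // leq_addr.
  rewrite /letter (tnth_nth sigma2) /= nth_cat kp.
  by move/allP: pre_pos; apply; apply: mem_nth.
have hi : (k - size pre < 9)%N by rewrite ltn_subLR // -[9%N]/(size beta_tail) -size_cat.
have -> : k = tail_crossing hi by apply: val_inj; rewrite /= subnKC.
rewrite letter_tail tail_crossing_eq; move: (k - size pre)%N hi.
by do 9?[case=> //].
Qed.

Lemma verticalE s k : vertical s k = (if k == T 4 then s k else ~~ s k).
Proof. by rewrite /vertical letter_positive; case: (k == T 4); case: (s k). Qed.

Definition zero_state : state Dw := [ffun=> false].

Lemma left_tail i (hi : (i < 9)%N) : left (tail_crossing hi) = (nth sigma2 beta_tail i).1 :> nat.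
Proof. by rewrite /left letter_tail. Qed.

Lemma between_tail i j (hi : (i < 9)%N) (hj : (j < 9)%N) (P : pred crossing) :
  (forall n (hn : (n < 9)%N), (i < n < j)%N -> P (tail_crossing hn)) ->
  forall k, (tail_crossing hi < k < tail_crossing hj)%N -> P k.
Proof.
move=> h k /= /andP[ik kj].
have kp : (size pre <= k)%N by apply: leq_trans (ltnW ik); apply: leq_addr.
have hk : (k - size pre < 9)%N by rewrite ltn_subLR // (ltn_trans kj) // ltn_add2l.
have -> : k = tail_crossing hk by apply: val_inj; rewrite /= subnKC.
by apply: h; rewrite ltn_subRL ltn_subLR // ik kj.
Qed.

(** [T 2] and [T 3] are vertical, so the strands leaving [T 1] reach the cap of [T 4]. Outside [U]
    the state may have letters smoothed to 1, which covers the faces met in [exact_cap]. *)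
Lemma exact0_tail U s0 : (forall k, k \in U -> s0 k = false) -> T 1 \in U ->
  s0 (T 2) = false -> s0 (T 3) = false -> s0 (T 4) = false -> exact_at U s0 0.
Proof.
move=> U0 eU h2 h3 h4; apply: (exact_split pl U0 eU).
apply: (@splits_below _ _ _ (T 1) (T 4)).
- by rewrite /= ltn_add2l.
- by apply: val_inj; rewrite /= !letter_tail.
- by rewrite verticalE tail_crossing_eq /= U0.
- by rewrite verticalE tail_crossing_eq /= h4.
apply: between_tail => n hn /andP[n1 n4]; rewrite verticalE.
rewrite tail_crossing_eq ltn_eqF //.
case: n hn n1 n4 => [|[|[|[|n]]]] // hn _ _.
  by rewrite (_ : tail_crossing hn = T 2) ?h2 //; apply: val_inj.
by rewrite (_ : tail_crossing hn = T 3) ?h3 //; apply: val_inj.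
Qed.

(** Signs are erased before letters are compared, because a generator and its inverse act on the
    same strands. The value [i != 4] is the smoothing that makes [i] a cap and cup: 1 for a positive
    letter, 0 for the negative one. *)
Lemma exact_kink_tail U s0 i j (hi : (i < 9)%N) (hj : (j < 9)%N) (n : nat) :
  (i < j)%N -> j != 4%N -> nth sigma2 [seq (x.1, true) | x <- beta_tail] i = nth sigma2 [seq (x.1, true) | x <- beta_tail] j ->
  tail_crossing hj \in U -> s0 (tail_crossing hj) = false ->
  tail_crossing hi \notin U -> s0 (tail_crossing hi) = (i != 4)%N ->
  (forall r (hr : (r < 9)%N), (i < r < j)%N ->
     [&& tail_crossing hr \notin U, r != 4%N & ~~ s0 (tail_crossing hr)]) ->
  exact_at (U :\ tail_crossing hj) (on s0 (tail_crossing hj)) n -> exact_at U s0 n.+1.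
Proof.
move=> ij j4 lij jU s0j iU s0i h; apply: (@exact_kink_braid _ _ _ _ _ (tail_crossing hi)) => //.
- by rewrite verticalE tail_crossing_eq (negPf j4) s0j.
- by rewrite /= ltn_add2l.
- apply: val_inj; rewrite /left /= !letter_tail.
  by move: lij; rewrite !(nth_map sigma2) // => -[->].
- by rewrite verticalE tail_crossing_eq s0i; case: (i == 4%N).
apply: between_tail => k hk ikj; have /and3P[kU k4 sk] := h k hk ikj.
by rewrite kU verticalE tail_crossing_eq (negPf k4).
Qed.

(** Resolving [T 5] first turns [T 6], then [T 7], into kinks next to the cup of
    [T 4], or [T 8] into a kink next to the cup of [T 5]; in weight 0, smoothing
    [T 1] splits off a circle together with the cap of [T 4]. *)
Lemma exact_cap n : (n <= 2)%N -> exact_at ([set: crossing] :\ T 4) zero_state n.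
Proof.
have mem i (hi : (i < 9)%N) : (tail_crossing hi \in [set: crossing] :\ T 4) = (i != 4)%N.
  by rewrite !inE tail_crossing_eq andbT.
have z k : zero_state k = false by rewrite ffunE.
have E1 : exact_at ([set: crossing] :\ T 4 :\ T 5) zero_state 1.
  apply: (@exact_kink_tail _ _ 4 6 isT isT) => //; rewrite ?inE ?ffunE ?tail_crossing_eq //.
    by move=> r hr /andP[]; case: r hr => [|[|[|[|[|[|r]]]]]] // hr _ _;
      rewrite !inE ffunE !tail_crossing_eq.
  apply: exact0_tail; rewrite ?inE ?ffunE ?tail_crossing_eq // => k.
  by rewrite !inE !ffunE => /andP[/negPf ->].
case: n => [|[|[|n]]] // _.
- by apply: exact0_tail => [k _||||]; rewrite ?inE ?ffunE ?tail_crossing_eq.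
- apply: (exactS pl (a := T 5)); rewrite ?mem ?z //.
  apply: exact0_tail; rewrite ?inE ?ffunE ?tail_crossing_eq // => k.
  by rewrite !inE !ffunE => /andP[/negPf ->].
apply: (exactS pl (a := T 5)); rewrite ?mem ?z //.
  (* With [T 5] vertical, [T 6] is a kink above the cup of [T 4], and after it is smoothed [T 7] is
     a kink above the cup of [T 6]. *)
  apply: (@exact_kink_tail _ _ 4 6 isT isT) => //; rewrite ?inE ?ffunE ?tail_crossing_eq //.
    by move=> r hr /andP[]; case: r hr => [|[|[|[|[|[|r]]]]]] // hr _ _;
      rewrite !inE ffunE !tail_crossing_eq.
  apply: (@exact_kink_tail _ _ 6 7 isT isT) => //; rewrite ?inE ?ffunE ?tail_crossing_eq //.
    by move=> r hr /andP[]; case: r hr => [|[|[|[|[|[|[|r]]]]]]].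
  apply: exact0_tail; rewrite ?inE ?ffunE ?tail_crossing_eq // => k.
  by rewrite !inE !ffunE => /and3P[/negPf -> /negPf ->].
(* With [T 5] smoothed, [T 6] and [T 7] are resolved only to clear the way from the cup of [T 5] to
   [T 8]. *)
apply: (exactS pl (a := T 6)); rewrite ?inE ?ffunE ?tail_crossing_eq //; last first.
  apply: exact0_tail; rewrite ?inE ?ffunE ?tail_crossing_eq // => k.
  by rewrite !inE !ffunE => /and3P[/negPf -> /negPf ->].
apply: (exactS pl (a := T 7)); rewrite ?inE ?ffunE ?tail_crossing_eq //; last first.
  apply: exact0_tail; rewrite ?inE ?ffunE ?tail_crossing_eq // => k.
  by rewrite !inE !ffunE => /and4P[/negPf -> _ /negPf ->].
apply: (@exact_kink_tail _ _ 5 8 isT isT) => //; rewrite ?inE ?ffunE ?tail_crossing_eq //.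
  by move=> r hr /andP[]; case: r hr => [|[|[|[|[|[|[|[|r]]]]]]]] // hr _ _;
      rewrite !inE !ffunE !tail_crossing_eq.
apply: exact0_tail; rewrite ?inE ?ffunE ?tail_crossing_eq // => k.
by rewrite !inE !ffunE => /and5P[/negPf -> _ _ /negPf ->].
Qed.

End Tail.

(** * Vertical states *)

Section VerticalState.
Variables (m : nat) (w : braid_word m).
Local Notation Dw := (braid_closure w).
Local Notation crossing := 'I_(size w).
Local Notation edge := (closure_edge w).
Local Notation label := {ffun edge -> bool}.
Local Notation same := (same_circle (D := Dw)).
Local Notation splits := (splits (D := Dw)).
Local Notation on := (on (D := Dw)).
Local Notation valid := (valid (D := Dw)).
Local Notation edge_map := (edge_map (D := Dw)).
Implicit Types (k : crossing) (e f : edge) (p : 'I_m.+1) (l : label).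
Let pl := braid_closure_planar w.

Variable s : state Dw.
Hypothesis vs : forall k, vertical s k.

Lemma same_vertical e f : same s e f = (e.2 == f.2).
Proof.
apply/idP/eqP; first by move: e f; apply: same_invariant => e f [p|k p _|k|k]; rewrite ?vs.
have P t p : same s (ord0, p) (t, p).
  by apply: vertical_path => // k _; rewrite vs orbT.
case: e f => [t p] [u q] /= ->; apply: (@same_trans Dw s (ord0, q)); last exact: P.
by rewrite same_sym; exact: P.
Qed.

Definition strand_label (b : 'I_m.+1 -> bool) : label := [ffun e => b e.2].

Lemma eq_strand_label b c : b =1 c -> strand_label b = strand_label c.
Proof. by move=> bc; apply/ffunP=> e; rewrite !ffunE bc. Qed.

Lemma valid_strand_label b : valid (s, strand_label b).
Proof. by apply/validP=> e f; rewrite same_vertical !ffunE => /eqP ->. Qed.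

Lemma valid_verticalE l : valid (s, l) -> l = strand_label (fun p => l (ord0, p)).
Proof.
move=> /validP vl; apply/ffunP=> e; rewrite ffunE; apply: vl.
by rewrite same_vertical.
Qed.

Definition touches k p := (p == left k) || (p == right k).

Lemma near_vertical k e : near (D := Dw) s k e = touches k e.2.
Proof.
rewrite /near !same_vertical arc1E arc3E /touches !(eq_sym e.2) /=.
by case: (letter k).2; rewrite // orbC.
Qed.

Lemma splits_vertical k : splits s k = false.
Proof.
rewrite /splits same_vertical arc1E arc3E /=.
by case: (letter k).2; rewrite ?left_neq_right // eq_sym left_neq_right.
Qed.

Lemma valid_on_vertical_label k b : s k = false -> b (left k) = b (right k) ->
  valid (on s k, strand_label b).
Proof.
move=> sk bk; apply/validP=> e f; rewrite (same_on_merge pl) ?splits_vertical //.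
rewrite same_vertical !near_vertical !ffunE /touches => /orP[/eqP -> //|].
by case/andP=> /orP[] /eqP -> /orP[] /eqP ->; rewrite ?bk.
Qed.

Lemma edge_map_vertical k (x : label -> int) b : s k = false -> b (left k) = b (right k) ->
  edge_map k s x (strand_label b) =
  if b (left k) then x (strand_label b)
  else x (strand_label (fun p => (p == left k) || b p)) +
       x (strand_label (fun p => (p == right k) || b p)).
Proof.
move=> sk bk.
have rE e : raise (D := Dw) s e (strand_label b) = strand_label (fun p => (p == e.2) || b p).
  by apply/ffunP=> f; rewrite !ffunE same_vertical eq_sym.
rewrite (edge_map_merge pl) ?splits_vertical //; last exact: valid_on_vertical_label.
rewrite !rE ffunE arc1E arc3E /=.
by case: (letter k).2; rewrite ?bk // addrC.
Qed.

Definition related k p q := (p == q) || (touches k p && touches k q).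

Lemma same_on_vertical k e f : s k = false -> same (on s k) e f = related k e.2 f.2.
Proof. by move=> sk; rewrite (same_on_merge pl) ?splits_vertical // same_vertical !near_vertical. Qed.

Lemma valid_on_vertical k l : s k = false -> valid (on s k, l) ->
  l = strand_label (fun p => l (ord0, p)) /\ l (ord0, left k) = l (ord0, right k).
Proof.
move=> sk /validP vl; split.
  by apply/ffunP=> e; rewrite ffunE; apply: vl; rewrite same_on_vertical // /related eqxx.
by apply: vl; rewrite same_on_vertical // /related /touches !eqxx /= !orbT.
Qed.

Lemma splits_on_vertical k j : s k = false -> left j != left k -> splits (on s k) j = false.
Proof.
move=> sk jk; have sym : related k (right j) (left j) = related k (left j) (right j).
  by rewrite /related eq_sym andbC.
have -> : splits (on s k) j = related k (left j) (right j).
  by rewrite /splits same_on_vertical // arc1E arc3E /=; case: (letter j).2.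
rewrite /related left_neq_right /touches (negPf jk) /=.
apply/negP=> /andP[/eqP/(congr1 val) /= h /orP[]/eqP/(congr1 val) /=]; rewrite /bump !add1n in h *;
  by move=> h'; clear -h h'; lia.
Qed.

Lemma valid_on2_vertical k j b : s k = false -> s j = false ->
  left j != left k -> b (left k) = b (right k) -> b (left j) = b (right j) ->
  valid (on (on s k) j, strand_label b).
Proof.
move=> sk sj jk bk bj.
have tj : on s k j = false by rewrite on_neq //; apply: contraNneq jk => ->.
have br p q : related k p q -> b p = b q.
  case/orP=> [/eqP -> //|/andP[]].
  by move=> /orP[] /eqP -> /orP[] /eqP ->; rewrite ?bk.
apply/validP=> e f; rewrite (same_on_merge pl) ?splits_on_vertical //.
rewrite /near !same_on_vertical // arc1E arc3E !ffunE /=.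
case/orP=> [/br //|/andP[]].
by case: (letter j).2 => /orP[] /br <- /orP[] /br <-; rewrite ?bj.
Qed.

Lemma edge_map_on_vertical k j (x : label -> int) b : s k = false -> s j = false ->
  left j != left k -> b (left k) = b (right k) -> b (left j) = b (right j) ->
  edge_map j (on s k) x (strand_label b) =
  if b (left j) then x (strand_label b)
  else x (strand_label (fun p => related k (left j) p || b p)) +
       x (strand_label (fun p => related k (right j) p || b p)).
Proof.
move=> sk sj jk bk bj.
have tj : on s k j = false by rewrite on_neq //; apply: contraNneq jk => ->.
have rE e : raise (D := Dw) (on s k) e (strand_label b) = strand_label (fun p => related k e.2 p || b p).
  by apply/ffunP=> f; rewrite !ffunE same_on_vertical.
rewrite (edge_map_merge pl) ?splits_on_vertical //; last exact: valid_on2_vertical.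
rewrite !rE ffunE arc1E arc3E /=.
by case: (letter j).2; rewrite ?bj // addrC.
Qed.

End VerticalState.

(** * Linear algebra of the three neighbour merges on V^{(x) 4} *)

Section StrandAlgebra.
Local Notation "0b" := false. Local Notation "1b" := true.
Implicit Types (x y v : bool -> bool -> bool -> bool -> int).

(** The hypotheses are the cocycle equations on the three faces of the cube of merges, and [y] is a
    primitive. Each [xi] is meaningful only where its two merged arguments agree. *)
Lemma strand_exact x1 x2 x3 :
  (forall a d, (if a then x1 1b 1b 1b d else x1 1b 1b 0b d + x1 0b 0b 1b d) =
               (if a then x2 1b 1b 1b d else x2 1b 0b 0b d + x2 0b 1b 1b d)) ->
  (forall a d, (if d then x2 a 1b 1b 1b else x2 a 1b 1b 0b + x2 a 0b 0b 1b) =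
               (if d then x3 a 1b 1b 1b else x3 a 1b 0b 0b + x3 a 0b 1b 1b)) ->
  (forall a d, (if d then x1 a a 1b 1b else x1 a a 1b 0b + x1 a a 0b 1b) =
               (if a then x3 1b 1b d d else x3 1b 0b d d + x3 0b 1b d d)) ->
  exists y,
  [/\ forall a c d, x1 a a c d = if a then y 1b 1b c d else y 1b 0b c d + y 0b 1b c d,
      forall a b d, x2 a b b d = if b then y a 1b 1b d else y a 1b 0b d + y a 0b 1b d &
      forall a b c, x3 a b c c = if c then y a b 1b 1b else y a b 1b 0b + y a b 0b 1b].
Proof.
move=> H12 H23 H13.
(* Two adjacent v_+ determine the value at once. The other values follow by solving one merge
   equation at a time, after choosing 0 at [0000] and [1000]; these two free choices match the
   parameters of [strand_kernel]. *)
exists (fun a b c d =>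
  if a && b then x1 1b 1b c d else if b && c then x2 a 1b 1b d
  else if c && d then x3 a b 1b 1b else
  if a && c then x2 1b 0b 0b 0b - x1 1b 1b 0b 0b
  else if b && d then x2 0b 0b 0b 1b - x3 0b 0b 1b 1b
  else if a && d then x1 0b 0b 0b 1b - x2 0b 0b 0b 1b + x3 0b 0b 1b 1b
  else if b then x1 0b 0b 0b 0b else if c then x2 0b 0b 0b 0b - x1 0b 0b 0b 0b
  else if d then x3 0b 0b 0b 0b - x2 0b 0b 0b 0b + x1 0b 0b 0b 0b else 0).
have := (H12 1b 1b, H12 1b 0b, H12 0b 1b, H12 0b 0b).
have := (H23 1b 1b, H23 1b 0b, H23 0b 1b, H23 0b 0b).
have := (H13 1b 1b, H13 1b 0b, H13 0b 1b, H13 0b 0b).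
move=> /= [[[h1 h2] h3] h4] [[[h5 h6] h7] h8] [[[h9 h10] h11] h12].
by clear H12 H23 H13; split=> [] [] [] [] /=; lia.
Qed.

(** A kernel element vanishes where two adjacent labels are v_+ and changes sign when a lone v_+
    moves to a neighbouring strand. This leaves v_-^{(x) 4} and the alternating sum of the labels
    with a single v_+. *)
Lemma strand_kernel v :
  (forall a c d, (if a then v 1b 1b c d else v 1b 0b c d + v 0b 1b c d) = 0) ->
  (forall a b d, (if b then v a 1b 1b d else v a 1b 0b d + v a 0b 1b d) = 0) ->
  (forall a b c, (if c then v a b 1b 1b else v a b 1b 0b + v a b 0b 1b) = 0) ->
  forall a b c d, v a b c d =
    (if (a + b + c + d == 0)%N then v 0b 0b 0b 0b
     else if (a + b + c + d == 1)%N then (if b || d then - v 1b 0b 0b 0b else v 1b 0b 0b 0b) else 0).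
Proof.
move=> H1 H2 H3.
have := (H1 1b 1b 1b, H1 1b 1b 0b, H1 1b 0b 1b, H1 1b 0b 0b).
have := (H1 0b 1b 1b, H1 0b 1b 0b, H1 0b 0b 1b, H1 0b 0b 0b).
have := (H2 1b 1b 1b, H2 1b 1b 0b, H2 0b 1b 1b, H2 0b 1b 0b).
have := (H2 1b 0b 1b, H2 1b 0b 0b, H2 0b 0b 1b, H2 0b 0b 0b).
have := (H3 1b 1b 1b, H3 1b 0b 1b, H3 0b 1b 1b, H3 0b 0b 1b).
have := (H3 1b 1b 0b, H3 1b 0b 0b, H3 0b 1b 0b, H3 0b 0b 0b).
move=> /= [[[? ?] ?] ?] [[[? ?] ?] ?] [[[? ?] ?] ?] [[[? ?] ?] ?] [[[? ?] ?] ?] [[[? ?] ?] ?].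
by clear H1 H2 H3; move=> [] [] [] [] /=; lia.
Qed.

End StrandAlgebra.

(** * Cocycles in weight one of a subcube *)

Section CubeWeightOne.
Variable D : link_diagram.
Local Notation crossing := 'I_(link_ncross D).
Implicit Types (s : state D) (j k : crossing) (U : {set crossing}).

Lemma cube_weight1 U s0 s : (forall k, k \in U -> s0 k = false) -> in_cube U s0 s ->
  cube_weight U s = 1%N -> exists2 k, k \in U & s = on s0 k.
Proof.
move=> U0 sU ws; have /card_gt0P[k] : (0 < cube_weight U s)%N by rewrite ws.
rewrite !inE => /andP[kU sk]; exists k => //.
rewrite -[LHS](offK sk); congr (on _ k).
apply: (cube_weight0 U0); first exact: in_cube_off.
by apply: succn_inj; rewrite -cube_weight_off.
Qed.

Lemma cube_diff_on2 U s0 j k (X : state D -> _ -> int) l :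
  (forall k, k \in U -> s0 k = false) -> j \in U -> k \in U -> j != k ->
  cube_diff U X (on (on s0 j) k) l =
  edge_sign k (on s0 j) * edge_map k (on s0 j) (X (on s0 j)) l +
  edge_sign j (on s0 k) * edge_map j (on s0 k) (X (on s0 k)) l.
Proof.
move=> U0 jU kU jk; rewrite (cube_diffD1 _ _ _ kU) on_id onK; last first.
  by rewrite on_neq 1?eq_sym ?U0.
congr (_ + _).
rewrite (@cube_diffD1 _ _ _ j) ?inE ?jk // onC on_id onK; last first.
  by rewrite on_neq ?U0.
rewrite [X in _ + X]big1 ?addr0 // => i; rewrite !inE !ffunE => /andP[/and3P[ij ik iU]].
by rewrite (negPf ij) (negPf ik) U0.
Qed.

Lemma cube_weight_on2 U s0 j k : (forall k, k \in U -> s0 k = false) -> j \in U ->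
  k \in U -> j != k -> cube_weight U (on (on s0 j) k) = 2%N.
Proof.
move=> U0 jU kU jk; rewrite (cube_weight_off kU (on_id _ _)) onK ?cube_weight_on //.
by rewrite on_neq ?U0 // eq_sym.
Qed.

Lemma in_cube_on2 U s0 j k : j \in U -> k \in U -> in_cube U s0 (on (on s0 j) k).
Proof. by move=> jU kU i iU; rewrite !on_neq //; apply: contraNneq iU => ->. Qed.

(** Absorbing the sign of the first edge into [X] turns the anticommuting square into a plain
    equality of two edge maps. *)
Lemma cocycle_weight1 U s0 j k X l : (forall k, k \in U -> s0 k = false) -> j \in U ->
  k \in U -> j != k -> cube_diff U X (on (on s0 j) k) l = 0 ->
  edge_map k (on s0 j) (fun l => edge_sign j s0 * X (on s0 j) l) l =
  edge_map j (on s0 k) (fun l => edge_sign k s0 * X (on s0 k) l) l.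
Proof.
move=> U0 jU kU jk; rewrite cube_diff_on2 // => E.
have sc i i' : edge_map i' (on s0 i) (fun l => edge_sign i s0 * X (on s0 i) l) l =
    edge_sign i s0 * edge_map i' (on s0 i) (X (on s0 i)) l.
  by rewrite /edge_map big_distrr.
rewrite !sc; have := edge_signC jk (U0 _ jU) (U0 _ kU).
have := edge_sign2 k (on s0 j); have := edge_sign2 j (on s0 k).
move: E; set P := edge_map _ _ _ l; set Q := edge_map _ _ _ l.
set al := edge_sign j s0; set be := edge_sign k s0.
set ga := edge_sign k (on s0 j); set de := edge_sign j (on s0 k).
move=> E d2 g2 ag.
transitivity (al * ga * (ga * P)); first by rewrite -[in LHS](mul1r P) -g2; ring.
transitivity (- (be * de) * - (de * Q)); last by rewrite -[in RHS](mul1r Q) -d2; ring.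
by rewrite ag (_ : ga * P = - (de * Q)) //; apply/eqP; rewrite -subr_eq0 opprK E.
Qed.

End CubeWeightOne.

(** * Edge maps between four vertical strands *)

Section FourStrands.
Variable w : braid_word 3.
Local Notation Dw := (braid_closure w).
Local Notation crossing := 'I_(size w).
Local Notation edge := (closure_edge w).
Local Notation label := {ffun edge -> bool}.
Local Notation splits := (splits (D := Dw)).
Local Notation on := (on (D := Dw)).
Local Notation valid := (valid (D := Dw)).
Local Notation edge_map := (edge_map (D := Dw)).
Local Notation exact_at := (exact_at (D := Dw)).
Implicit Types (j k : crossing) (l : label) (x : label -> int) (a b c d : bool).
Let pl := braid_closure_planar w.

Variable s : state Dw.
Hypothesis vs : forall k, vertical s k.

Definition strands4 a b c d : label :=
  strand_label w (fun p : 'I_4 => nth false [:: a; b; c; d] p).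

Definition eval4 x a b c d := x (strands4 a b c d).

Lemma eq_left k p q : left k = q :> nat -> (p == left k) = (p == q :> nat).
Proof. by move=> <-. Qed.

Lemma eq_right k p q : left k = q :> nat -> (p == right k) = (p == q.+1 :> nat).
Proof. by move=> <-. Qed.

Lemma touchesE k p q : left k = q :> nat ->
  touches k p = (p == q :> nat) || (p == q.+1 :> nat).
Proof. by move=> kq; rewrite /touches (eq_left _ kq) (eq_right _ kq). Qed.

Lemma relatedE k p p' q : left k = q :> nat -> related k p p' =
  (p == p' :> nat) || ((p == q :> nat) || (p == q.+1 :> nat)) &&
                      ((p' == q :> nat) || (p' == q.+1 :> nat)).
Proof. by move=> kq; rewrite /related !(touchesE _ kq). Qed.

Lemma edge_map_strand0 k x a c d : s k = false -> left k = 0%N :> nat ->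
  edge_map k s x (strands4 a a c d) =
  if a then eval4 x true true c d else eval4 x true false c d + eval4 x false true c d.
Proof.
move=> sk kq; rewrite edge_map_vertical //; last by rewrite right_val kq.
rewrite kq /=.
case: a => //; congr (_ + _); congr x; apply: eq_strand_label => p;
  rewrite ?(eq_left _ kq) ?(eq_right _ kq);
  by case: p => -[|[|[|[|?]]]] ?.
Qed.

Lemma edge_map_strand1 k x a b d : s k = false -> left k = 1%N :> nat ->
  edge_map k s x (strands4 a b b d) =
  if b then eval4 x a true true d else eval4 x a true false d + eval4 x a false true d.
Proof.
move=> sk kq; rewrite edge_map_vertical //; last by rewrite right_val kq.
rewrite kq /=.
case: b => //; congr (_ + _); congr x; apply: eq_strand_label => p;
  rewrite ?(eq_left _ kq) ?(eq_right _ kq);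
  by case: p => -[|[|[|[|?]]]] ?.
Qed.

Lemma edge_map_strand2 k x a b c : s k = false -> left k = 2%N :> nat ->
  edge_map k s x (strands4 a b c c) =
  if c then eval4 x a b true true else eval4 x a b true false + eval4 x a b false true.
Proof.
move=> sk kq; rewrite edge_map_vertical //; last by rewrite right_val kq.
rewrite kq /=.
case: c => //; congr (_ + _); congr x; apply: eq_strand_label => p;
  rewrite ?(eq_left _ kq) ?(eq_right _ kq);
  by case: p => -[|[|[|[|?]]]] ?.
Qed.

Lemma strands4E (f : nat -> bool) :
  strand_label w (fun p : 'I_4 => f p) = strands4 (f 0%N) (f 1%N) (f 2%N) (f 3%N).
Proof. by apply: eq_strand_label => -[[|[|[|[|?]]]] ?]. Qed.

Lemma edge_map_on_strands k j x q r a b c d : s k = false -> s j = false ->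
  left k = q :> nat -> left j = r :> nat -> q != r ->
  let u := nth false [:: a; b; c; d] in
  u q = u q.+1 -> u r = u r.+1 ->
  let raise (t p : nat) :=
    [|| t == p, ((t == q) || (t == q.+1)) && ((p == q) || (p == q.+1)) | u p] in
  let raised t := eval4 x (raise t 0%N) (raise t 1%N) (raise t 2%N) (raise t 3%N) in
  edge_map j (on s k) x (strands4 a b c d) =
  if u r then eval4 x a b c d else raised r + raised r.+1.
Proof.
move=> sk sj kq jr qr u uq ur raise raised.
rewrite edge_map_on_vertical // ?right_val ?kq ?jr //; last first.
  by rewrite (eq_left _ kq) jr eq_sym.
rewrite -/(u r); case: ifP => // _; rewrite /raised /eval4 -(strands4E (raise r)) -(strands4E (raise r.+1)).
congr (_ + _); congr x; apply: eq_strand_label => p;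
  by rewrite (relatedE _ _ kq) ?right_val ?jr -orbA.
Qed.

Lemma valid_on_strands k l : s k = false -> valid (on s k, l) ->
  exists u : seq bool, [/\ size u = 4, nth false u (left k) = nth false u (left k).+1 &
    l = strand_label w (fun p : 'I_4 => nth false u p)].
Proof.
move=> sk vl; have [lE lk] := valid_on_vertical vs sk vl.
exists [seq l (ord0, p) | p <- enum 'I_4].
have nthE (p : 'I_4) : nth false [seq l (ord0, p) | p <- enum 'I_4] p = l (ord0, p).
  by rewrite (nth_map p) ?size_enum_ord // nth_ord_enum.
rewrite size_map size_enum_ord -right_val !nthE; split=> //.
by rewrite [LHS]lE; apply: eq_strand_label => p; rewrite nthE.
Qed.

Lemma exact_strands k0 k1 k2 : s k0 = false -> s k1 = false -> s k2 = false ->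
  left k0 = 0%N :> nat -> left k1 = 1%N :> nat -> left k2 = 2%N :> nat ->
  exact_at [set k0; k1; k2] s 1.
Proof.
move=> s0 s1 s2 q0 q1 q2 X dX; set U := [set k0; k1; k2].
have n01 : k0 != k1 by apply/eqP=> h; rewrite h q1 in q0.
have n12 : k1 != k2 by apply/eqP=> h; rewrite h q2 in q1.
have n02 : k0 != k2 by apply/eqP=> h; rewrite h q2 in q0.
have U0 k : k \in U -> s k = false by rewrite !inE -orbA => /or3P[] /eqP ->.
have [h0 h1 h2] : [/\ k0 \in U, k1 \in U & k2 \in U] by rewrite !inE !eqxx !orbT.
pose x k := eval4 (fun l => edge_sign (D := Dw) k s * X (on s k) l).
have x_eq k a b c d : x k a b c d = edge_sign (D := Dw) k s * X (on s k) (strands4 a b c d).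
  by [].
have valid4 j k q r a b c d : j \in U -> k \in U -> j != k ->
    left j = q :> nat -> left k = r :> nat -> q != r ->
    nth false [:: a; b; c; d] q = nth false [:: a; b; c; d] q.+1 ->
    nth false [:: a; b; c; d] r = nth false [:: a; b; c; d] r.+1 ->
    valid (on (on s j) k, strands4 a b c d).
  move=> jU kU jk jq kr qr uq ur; apply: valid_on2_vertical; rewrite ?U0 ?right_val ?jq ?kr //.
  by rewrite (eq_left _ jq) kr eq_sym.
have cyc4 j k a b c d q r jU kU jk jq kr qr uq ur :=
  cocycle_weight1 (D := Dw) U0 jU kU jk (dX _ _ (in_cube_on2 (D := Dw) s jU kU)
    (cube_weight_on2 (D := Dw) U0 jU kU jk) (@valid4 j k q r a b c d jU kU jk jq kr qr uq ur)).
have [y [y0 y1 y2]] : exists y,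
  [/\ forall a c d, x k0 a a c d = if a then y true true c d else y true false c d + y false true c d,
      forall a b d, x k1 a b b d = if b then y a true true d else y a true false d + y a false true d &
      forall a b c, x k2 a b c c = if c then y a b true true else y a b true false + y a b false true].
  apply: strand_exact => a d.
  - have := cyc4 k0 k1 a a a d 0%N 1%N h0 h1 n01 q0 q1 isT erefl erefl.
    rewrite (edge_map_on_strands _ s0 s1 q0 q1) // (edge_map_on_strands _ s1 s0 q1 q0) //.
    by case: a.
  - have := cyc4 k1 k2 a d d d 1%N 2%N h1 h2 n12 q1 q2 isT erefl erefl.
    rewrite (edge_map_on_strands _ s1 s2 q1 q2) // (edge_map_on_strands _ s2 s1 q2 q1) //.
    by case: d; case: a.
  - have := cyc4 k0 k2 a a d d 0%N 2%N h0 h2 n02 q0 q2 isT erefl erefl.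
    rewrite (edge_map_on_strands _ s0 s2 q0 q2) // (edge_map_on_strands _ s2 s0 q2 q0) //.
    by case: d; case: a.
(* In weight 0 only the state [s] occurs, so the state argument may be ignored; the label of a
   strand is read off at level 0. *)
pose Y (_ : state Dw) (l : label) := y (l (ord0, inord 0)) (l (ord0, inord 1))
  (l (ord0, inord 2)) (l (ord0, inord 3)).
have YE t a b c d : eval4 (Y t) a b c d = y a b c d.
  by rewrite /eval4 /Y /strands4 !ffunE /= !inordK.
exists Y => t l tU wt vl.
have [k kU tE] := cube_weight1 (D := Dw) U0 tU wt; rewrite {}tE in vl *.
rewrite (cube_diff_on (D := Dw) _ _ U0 kU).
have sk := U0 _ kU.
have [u [size_u uk ->]] := valid_on_strands sk vl.
case: u size_u uk => [|a [|b [|c [|d [|]]]]] // _ uk.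
rewrite -/(strands4 a b c d) -[LHS]mul1r -(edge_sign2 (D := Dw) k s) -mulrA; congr (_ * _).
rewrite -[LHS]/(x k a b c d).
move: (kU); rewrite !inE -orbA => /or3P[] /eqP kE; rewrite {}kE in uk sk *.
- move: uk; rewrite q0 /= => ->; rewrite edge_map_strand0 // !YE; exact: y0.
- move: uk; rewrite q1 /= => ->; rewrite edge_map_strand1 // !YE; exact: y1.
- move: uk; rewrite q2 /= => ->; rewrite edge_map_strand2 // !YE; exact: y2.
Qed.

End FourStrands.

(** * The cube of the identity smoothing *)

Lemma ffun_intmulE (I : finType) (f : {ffun I -> int}) (n : int) (i : I) :
  (f *~ n) i = n * f i.
Proof.
case: n => n; first by rewrite -pmulrn ffunMnE -mulr_natl natz.
by rewrite NegzE mulrNz ffunE -pmulrn ffunMnE mulNr -mulr_natl natz.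
Qed.

Section Identity.
Variable pre : braid_word 3.
Hypothesis pre_pos : all snd pre.
Local Notation w := (pre ++ beta_tail).
Local Notation Dw := (braid_closure w).
Local Notation crossing := 'I_(size w).
Local Notation edge := (closure_edge w).
Local Notation label := {ffun edge -> bool}.
Local Notation on := (on (D := Dw)).
Local Notation exact_at := (exact_at (D := Dw)).
Local Notation T i := (@tail_crossing pre i isT).
Local Notation edge_map := (edge_map (D := Dw)).
Local Notation valid := (valid (D := Dw)).
Implicit Types (s : state Dw) (k : crossing) (U : {set crossing}) (l : label).
Let pl := braid_closure_planar w.

(** A positive crossing is vertical in its 0-smoothing and a negative one in its 1-smoothing. This
    is the identity braid, whose closure has the four strands as circles. *)
Definition vertical_state : state Dw := on (zero_state pre) (T 4).
Local Notation s1 := vertical_state.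

Lemma vertical_stateE k : s1 k = (k == T 4).
Proof. by rewrite !ffunE orbF. Qed.

Lemma vertical_vertical_state k : vertical s1 k.
Proof. by rewrite verticalE // vertical_stateE; case: (k == T 4). Qed.

Lemma left_cases k : [\/ left k = 0%N :> nat, left k = 1%N :> nat | left k = 2%N :> nat].
Proof.
have lk : (left k < 3)%N by exact: (ltn_ord (letter k).1).
by case: (nat_of_ord (left k)) lk => [|[|[|t]]] // _; [apply: Or31 | apply: Or32 | apply: Or33].
Qed.

Lemma exact_identity_core U : [set T 1; T 0; T 2] \subset U ->
  U \subset [set: crossing] :\ T 4 -> exact_at U s1 1.
Proof.
(* One letter each for sigma1, sigma2 and sigma3, in the order that [exact_strands] expects. *)
set C := [set T 1; T 0; T 2].
have [n] := ubnP #|U :\: C|; elim: n U => // n IH U Un CU US.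
have U0 k : k \in U -> s1 k = false.
  by move=> /(subsetP US); rewrite !inE andbT vertical_stateE => /negbTE.
have [UC|/subsetPn[a aU aC]] := boolP (U \subset C).
  have -> : U = C by apply/eqP; rewrite eqEsubset UC.
  by apply: (exact_strands vertical_vertical_state);
    rewrite ?vertical_stateE ?tail_crossing_eq // left_tail.
have CUa : C \subset U :\ a by rewrite subsetD1 CU.
apply: (exactS pl aU (U0 _ aU)).
  apply: IH => //; last by apply: subset_trans US; exact: subsetDl.
  rewrite ltnS in Un; apply: leq_trans Un; apply: proper_card; apply/properP; split.
    by apply/subsetP=> k; rewrite !inE => /and3P[-> _ ->].
  by exists a; rewrite !inE ?eqxx ?andbF // aU andbT; move: aC; rewrite !inE.
(* When [a] is smoothed, all other letters are vertical, so its cap or cup reaches the letter of [C]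
   on the same strands, wherever that letter stands, and makes it a split. *)
have [k kC lk] : exists2 k, k \in C & left k = left a.
  by case: (left_cases a) => la; [exists (T 1) | exists (T 0) | exists (T 2)];
    rewrite ?inE ?eqxx ?orbT //; apply: val_inj; rewrite [RHS]la; exact: left_tail.
have ka : k != a by apply: contraNneq aC => <-.
have kU : k \in U :\ a by apply: (subsetP CUa).
have vk j : j != a -> vertical (on s1 a) j.
  move=> ja; have := vertical_vertical_state j.
  by rewrite /vertical on_neq.
have va : ~~ vertical (on s1 a) a.
  rewrite verticalE // on_id; move: aU => /(subsetP US).
  by rewrite !inE andbT => /negbTE ->.
apply: (exact_split pl _ kU).
  move=> j; rewrite !inE => /andP[ja jU]; by rewrite on_neq ?U0.
case: (ltngtP k a) => [h|h|/val_inj h]; last by rewrite h eqxx in ka.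
- apply: (splits_below h) => //; first exact: vk.
  by move=> j /andP[_ ja]; apply: vk; rewrite -val_eqE ltn_eqF.
- apply: (splits_above h) => //; first exact: vk.
  by move=> j /andP[ja _]; apply: vk; rewrite -val_eqE gtn_eqF.
Qed.

Lemma exact_identity : exact_at ([set: crossing] :\ T 4) s1 1.
Proof.
apply: exact_identity_core => //; apply/subsetP=> k.
by rewrite !inE -orbA => /or3P[] /eqP ->; rewrite tail_crossing_eq.
Qed.

Lemma strands_of l : valid (s1, l) -> exists a b c d, l = strands4 w a b c d.
Proof.
move=> vl; rewrite (valid_verticalE vertical_vertical_state vl).
exists (l (ord0, inord 0)), (l (ord0, inord 1)), (l (ord0, inord 2)), (l (ord0, inord 3)).
by apply: eq_strand_label => -[[|[|[|[|p]]]] hp] //=; congr (l (_, _)); apply: val_inj;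
  rewrite /= inordK.
Qed.

Lemma strands4_plus (p : 'I_4) a b c d : strands4 w a b c d (ord0, p) = nth false [:: a; b; c; d] p.
Proof. by rewrite ffunE. Qed.

(** The general element of the kernel in [strand_kernel]: [x] times v_-^{(x) 4} plus [y] times the
    alternating sum. *)
Definition strand_cocycle (x y : int) l : int :=
  let: (a, b, c, d) := (l (ord0, inord 0), l (ord0, inord 1), l (ord0, inord 2), l (ord0, inord 3)) in
  if (a + b + c + d == 0)%N then x
  else if (a + b + c + d == 1)%N then (if b || d then - y else y) else 0.

Lemma strand_cocycleE x y a b c d : strand_cocycle x y (strands4 w a b c d) =
  if (a + b + c + d == 0)%N then x
  else if (a + b + c + d == 1)%N then (if b || d then - y else y) else 0.
Proof. by rewrite /strand_cocycle !strands4_plus !inordK. Qed.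

(** Every such letter merges two neighbouring strands, on which the alternating signs cancel. *)
Lemma strand_cocycleP k x y l : k != T 4 -> valid (on s1 k, l) ->
  edge_map k s1 (strand_cocycle x y) l = 0.
Proof.
move=> k4 vl; have sk : s1 k = false by rewrite vertical_stateE; apply/negbTE.
have [u [su uk ->]] := valid_on_strands vertical_vertical_state sk vl.
case: u su uk => [|a [|b [|c [|d [|]]]]] // _; rewrite -/(strands4 w a b c d).
case: (left_cases k) => lk; rewrite lk /= => ->.
- rewrite (edge_map_strand0 vertical_vertical_state) // /eval4 !strand_cocycleE.
  by case: b; case: c; case: d => //=; rewrite ?addr0 ?subrr ?addNr.
- rewrite (edge_map_strand1 vertical_vertical_state) // /eval4 !strand_cocycleE.
  by case: a; case: c; case: d => //=; rewrite ?addr0 ?subrr ?addNr.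
- rewrite (edge_map_strand2 vertical_vertical_state) // /eval4 !strand_cocycleE.
  by case: a; case: b; case: d => //=; rewrite ?addr0 ?subrr ?addNr.
Qed.

Lemma strand_kernelP (v : label -> int) :
  (forall k l, k != T 4 -> valid (on s1 k, l) -> edge_map k s1 v l = 0) ->
  exists x y, forall l, valid (s1, l) -> v l = strand_cocycle x y l.
Proof.
move=> v0; exists (eval4 v false false false false), (eval4 v true false false false) => l vl.
have [a [b [c [d ->]]]] := strands_of vl; rewrite strand_cocycleE.
have sT i (hi : (i < 9)%N) : i != 4%N -> s1 (tail_crossing pre hi) = false.
  by move=> i4; rewrite vertical_stateE tail_crossing_eq (negPf i4).
have vT i (hi : (i < 9)%N) a0 b0 c0 d0 : i != 4%N ->
    nth false [:: a0; b0; c0; d0] (nth sigma2 beta_tail i).1 =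
    nth false [:: a0; b0; c0; d0] (nth sigma2 beta_tail i).1.+1 ->
    edge_map (tail_crossing pre hi) s1 v (strands4 w a0 b0 c0 d0) = 0.
  move=> i4 h; apply: v0; first by rewrite tail_crossing_eq.
  apply: (valid_on_vertical_label vertical_vertical_state); first exact: sT.
  by rewrite [nat_of_ord (right _)]right_val !left_tail.
rewrite -[LHS]/(eval4 v a b c d).
apply: strand_kernel => {}a {}b {}c.
- by rewrite -(vT 1%N isT a a b c) // (edge_map_strand0 vertical_vertical_state) ?sT ?left_tail.
- by rewrite -(vT 0%N isT a b b c) // (edge_map_strand1 vertical_vertical_state) ?sT ?left_tail.
- by rewrite -(vT 2%N isT a b c c) // (edge_map_strand2 vertical_vertical_state) ?sT ?left_tail.
Qed.

Lemma n_minus1 : n_minus Dw = 1%N.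
Proof.
rewrite /n_minus (eq_card (B := pred1 (T 4))) ?card1 // => k.
by rewrite !inE /= -/(letter k) letter_positive // negbK.
Qed.

Lemma n_plusE : n_plus Dw = (size pre + 8)%N.
Proof.
have : (n_plus Dw + n_minus Dw = size w)%N.
  by rewrite -[RHS]card_ord; exact: (cardC [pred k : crossing | (letter k).2]).
by rewrite n_minus1 size_cat /=; lia.
Qed.

Lemma weight_vertical_state : weight s1 = 1%N.
Proof.
rewrite /weight (eq_card (B := pred1 (T 4))) ?card1 // => k.
by rewrite !inE /= vertical_stateE.
Qed.

(** The circles give twice the number of v_+ minus 4; the weight 1, the [size pre + 8] positive
    letters and -2 for the negative one add [size pre + 7]. *)
Lemma qdeg_strands a b c d :
  qdeg (s1, strands4 w a b c d) = (size pre)%:Z + 3 + ((a + b + c + d) * 2)%N%:Z.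
Proof.
have vl : valid (s1, strands4 w a b c d).
  exact: (valid_strand_label vertical_vertical_state).
rewrite /qdeg /= -/(circle_sum s1 _) weight_vertical_state n_minus1 n_plusE.
have -> : circle_sum s1 (strands4 w a b c d) =
    \sum_(p < 4) circle_sign (nth false [:: a; b; c; d] p).
  rewrite /circle_sum (_ : circles s1 = [set circle_of s1 (ord0, p) | p in 'I_4]).
    rewrite big_imset /=; last first.
      move=> p q _ _ pq; have : same_circle (D := Dw) s1 (ord0, p) (ord0, q).
        by rewrite -eq_circle_of pq.
      by rewrite (same_vertical vertical_vertical_state) => /eqP.
    by apply: eq_bigr => p _; rewrite circle_plus_of // strands4_plus.
  rewrite circlesE; apply/setP=> C; apply/imsetP/imsetP=> -[e _ ->].
    exists e.2 => //; apply/eqP.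
    by rewrite eq_circle_of (same_vertical vertical_vertical_state).
  by exists (ord0, e).
rewrite !big_ord_recl big_ord0 /= /circle_sign.
by case: a vl; case: b; case: c; case: d => _ /=; lia.
Qed.

End Identity.

(** * Khovanov homology in low degrees *)

Section LowDegrees.
Variable pre : braid_word 3.
Hypothesis pre_pos : all snd pre.
Local Notation w := (pre ++ beta_tail).
Local Notation Dw := (braid_closure w).
Local Notation crossing := 'I_(size w).
Local Notation edge := (closure_edge w).
Local Notation label := {ffun edge -> bool}.
Local Notation on := (on (D := Dw)).
Local Notation exact_at := (exact_at (D := Dw)).
Local Notation T i := (@tail_crossing pre i isT).
Local Notation valid := (valid (D := Dw)).
Local Notation cube_diff := (cube_diff (D := Dw)).
Local Notation extend := (extend (D := Dw)).
Local Notation restrict := (restrict (D := Dw)).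
Implicit Types (s : state Dw) (k : crossing) (U : {set crossing}) (l : label).
Let pl := braid_closure_planar w.
Local Notation s0 := (zero_state pre).
Local Notation s1 := (vertical_state pre).
Local Notation U1 := ([set: crossing] :\ T 4).

Lemma zero_stateE k : s0 k = false. Proof. by rewrite ffunE. Qed.

Lemma hdegE s l : hdeg (s, l) = (weight s)%:Z - 1.
Proof. by rewrite /hdeg n_minus1. Qed.

Lemma extend_cocycle i j (b : chain Dw i j) s l : diff (i + 1) b = 0 -> valid (s, l) ->
  cube_diff setT (extend b) s l = 0.
Proof. by move=> db vl; rewrite (extend_diff pl b erefl) // db extend0. Qed.

(** The primitive from the cube is ungraded, and restricting it to degree [j] is harmless because
    the differential preserves that degree. *)
Lemma Kh_exact (n : nat) (i j : int) : i = n%:Z - 1 -> exact_at setT s0 n ->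
  forall x : Kh Dw i j, x = 0.
Proof.
move=> iE E; apply: homology_eq0 => b db.
have [|Y bY] := E (extend b); first by move=> s l _ _ vl; exact: extend_cocycle.
exists (restrict (i - 1) j Y); apply/ffunP=> S.
rewrite (diff_restrict pl _ _ (esym (subrK 1 i))) -extendE.
case: S => [[s l] /= /and3P[vl hs qs]]; rewrite bY //; first exact: in_cubeT.
by rewrite cube_weightT; move: hs; rewrite hdegE iE => /eqP; lia.
Qed.

Lemma Kh_below (i j : int) : i < -1 -> forall x : Kh Dw i j, x = 0.
Proof.
move=> iN; apply: homology_eq0 => b _; exists 0; apply/ffunP=> S.
case: S => [[s l] h]; exfalso; move: h => /= /and3P[_ /eqP + _].
by rewrite hdegE; lia.
Qed.

Lemma exact_minus1 : exact_at setT s0 0.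
Proof.
by apply: exact0_tail => // [k _||||]; rewrite ?inE ?zero_stateE.
Qed.

Lemma exact_plus1 : exact_at setT s0 2.
Proof.
apply: (exactS pl (a := T 4)); rewrite ?inE ?zero_stateE //.
  exact: exact_cap.
exact: exact_identity.
Qed.

Lemma weight1_on s : s (T 4) -> weight s = 1%N -> s = s1.
Proof.
move=> s4 ws; have [|||k _ sE] := @cube_weight1 Dw setT s0 s.
- by move=> k _; rewrite zero_stateE.
- exact: in_cubeT.
- by rewrite cube_weightT.
by move: s4; rewrite sE ffunE zero_stateE orbF => /eqP <-.
Qed.

(** The cap-cup face is exact in weight 1, so a coboundary moves [b] onto the states with [T 4]
    smoothed. In weight 1 this is [s1] alone, where being a cocycle means lying in the kernel of all
    merges. *)
Lemma Kh0_reduce j (b : chain Dw 0 j) : diff (0 + 1) b = 0 ->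
  exists x y (a : chain Dw (0 - 1) j), forall S : basis Dw 0 j,
  b S = diff 0 a S + (if (val S).1 (T 4) then strand_cocycle x y (val S).2 else 0).
Proof.
move=> db.
have TU : T 4 \in [set: crossing] by rewrite inE.
have dX s l : in_cube setT s0 s -> cube_weight setT s = 2%N -> valid (s, l) ->
    cube_diff setT (extend b) s l = 0.
  by move=> _ _ vl; exact: extend_cocycle.
have E1 := exact_cap pre_pos (leqnSn 1).
have [Z [XZ dv]] := cocycle_move (D := Dw) pl TU (zero_stateE _) dX
  (E1 _ (cocycle_off (D := Dw) TU (zero_stateE _) dX)).
rewrite -/s1 in dv.
pose v l := extend b s1 l - cube_diff setT Z s1 l.
have U10 k : k \in U1 -> s1 k = false.
  by rewrite !inE andbT vertical_stateE => /negbTE.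
have [|x [y vE]] := @strand_kernelP _ pre_pos v.
  move=> k l k4 vl; have kU : k \in U1 by rewrite !inE k4.
  have := dv (on s1 k) l (in_cube_on (D := Dw) _ kU) (cube_weight_on (D := Dw) U10 kU) vl.
  rewrite (cube_diff_on (D := Dw) _ _ U10 kU) => h.
  by rewrite -[LHS]mul1r -(edge_sign2 (D := Dw) k s1) -mulrA h mulr0.
exists x, y, (restrict (0 - 1) j Z) => S.
rewrite (diff_restrict pl _ _ (esym (subrK 1 0))) -extendE.
case: S => [[s l] /= /and3P[vl /eqP hs qs]].
have ws : weight s = 1%N by move: hs; rewrite hdegE; lia.
case: ifP => s4.
  rewrite (weight1_on s4 ws) in vl *.
  by rewrite -vE // /v addrC subrK.
by rewrite addr0 XZ ?cube_weightT //; exact: in_cubeT.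
Qed.

Lemma qdeg_basis0 j (S : basis Dw 0 j) : (val S).1 (T 4) ->
  exists a b c d, [/\ (val S).2 = strands4 w a b c d, (val S).1 = s1 &
  j = (size pre)%:Z + 3 + ((a + b + c + d) * 2)%N%:Z].
Proof.
case: S => [[s l] /= /and3P[vl /eqP hs /eqP qs]] s4.
have ws : weight s = 1%N by move: hs; rewrite hdegE; lia.
have sE := weight1_on s4 ws; rewrite sE in vl qs *.
have [a [b [c [d lE]]]] := strands_of pre_pos vl.
exists a, b, c, d; split=> //.
by rewrite -qs lE qdeg_strands.
Qed.

Lemma Kh0_eq0 j : j <> (size pre)%:Z + 3 -> j <> (size pre)%:Z + 5 ->
  forall x : Kh Dw 0 j, x = 0.
Proof.
move=> j3 j5; apply: homology_eq0 => b db.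
have [x [y [a bE]]] := Kh0_reduce db.
exists a; apply/ffunP=> S; rewrite bE; case: ifP => s4; rewrite ?addr0 //.
have [a' [b' [c [d [-> _ jE]]]]] := qdeg_basis0 s4.
rewrite strand_cocycleE; move: jE; case: eqP => [->|n0]; first by rewrite addr0 => /j3.
case: eqP => [->|n1]; last by rewrite addr0.
by move=> jE; exfalso; apply: j5; rewrite jE; lia.
Qed.

(** The primitive [a] lives in weight 0, that is, at [s0]. Its coboundary vanishes on the cap-cup
    face, which is exact in weight 0, so [a] is 0. *)
Lemma zero_coboundary j (f : chain Dw 0 j) (a : chain Dw (0 - 1) j) : diff 0 a = f ->
  (forall S : basis Dw 0 j, (val S).1 (T 4) = false -> f S = 0) -> f = 0.
Proof.
move=> af f0.
have dA s l : valid (s, l) -> cube_diff setT (extend a) s l = extend f s l.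
  by move=> vl; rewrite (extend_diff pl a (esym (subrK 1 0))) // af.
have TU : T 4 \in [set: crossing] by rewrite inE.
have E0 := exact_cap pre_pos (leq0n 2); have [|Y AY] := E0 (extend a).
  move=> s l sU _ vl.
  have s4 : s (T 4) = false.
    by have [_ ->] := (in_cubeD1 (D := Dw) s (zero_stateE _) TU).1 sU.
  have := dA _ _ vl; rewrite (cube_diffD1 (D := Dw) _ _ _ TU) s4 add0r => ->.
  rewrite /extend; case: insubP => // S _ SE; apply: f0.
  by rewrite SE.
have A0 l : valid (s0, l) -> extend a s0 l = 0.
  move=> vl; rewrite AY //; last first.
    by apply: eq_card0 => k; rewrite !inE zero_stateE andbF.
  by rewrite /cube_diff big1 // => k; rewrite zero_stateE andbF.
apply/ffunP=> S; rewrite [RHS]ffunE; case s4: ((val S).1 (T 4)); last exact: f0.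
rewrite -extendE -dA; last by case: S s4 => [[s l] /= /and3P[]].
have [_ [_ [_ [_ [_ -> _]]]]] := qdeg_basis0 s4.
rewrite (cube_diff_on (D := Dw)) //; last by move=> k _; rewrite zero_stateE.
rewrite (@edge_map_ext _ _ _ _ (fun _ => 0)) ?[edge_map _ _ _ _]big1 ?mulr0 //.
Qed.

Lemma Kh0_iso j : j = (size pre)%:Z + 3 \/ j = (size pre)%:Z + 5 ->
  zmod_iso (Kh Dw 0 j) int.
Proof.
move=> jj.
(* Restriction to degree [j] keeps exactly one of the two summands, v_-^{(x) 4} or the alternating
   sum, so one formula serves both degrees. *)
pose Z s l : int := if s (T 4) then strand_cocycle 1 1 l else 0.
have ZE (S : basis Dw 0 j) : restrict 0 j Z S = Z (val S).1 (val S).2 by rewrite ffunE.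
apply: (homology_int (z0 := restrict 0 j Z)).
- apply/ffunP=> S; rewrite (diff_restrict pl) // [RHS]ffunE.
  case: S => [[s l] /= /and3P[vl /eqP hs _]].
  have ws : weight s = 2%N by move: hs; rewrite hdegE; lia.
  rewrite /cube_diff big1 // => k /andP[_ sk].
  rewrite /Z; case s4: (off s k (T 4)); last first.
    by rewrite [edge_map _ _ _ _]big1 ?mulr0.
  have k4 : k != T 4 by apply: contraTneq s4 => ->; rewrite off_id.
  have wk : weight (off s k) = 1%N.
    by have := weight_on (D := Dw) (off_id s k); rewrite offK // ws => -[].
  have sE := weight1_on s4 wk.
  have vl' : valid (on s1 k, l) by rewrite -sE offK.
  by rewrite sE (strand_cocycleP pre_pos _ _ k4 vl') mulr0.
- move=> b db; have [x [y [a bE]]] := Kh0_reduce db.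
  exists a, (if j == (size pre)%:Z + 3 then x else y).
  apply/ffunP=> S; rewrite bE [RHS]ffunE addrC ffun_intmulE ZE /Z; congr (_ + _).
  case: ifP => s4; last by rewrite mulr0.
  have [a' [b' [c [d [-> _ jE]]]]] := qdeg_basis0 s4.
  rewrite !strand_cocycleE; move: jj; rewrite jE.
  by case: a' {jE}; case: b'; case: c; case: d => /= jE; case: eqP; lia.
move=> a n an.
have z0 : restrict 0 j Z *~ n = 0.
  apply: (@zero_coboundary _ _ a); first by rewrite an.
  by move=> S s4; rewrite ffun_intmulE ZE /Z s4 mulr0.
(* A label of degree [j] at which the generator has coefficient 1: all v_-, or v_+ on strand 0
   only. *)
pose t := j == (size pre)%:Z + 5.
have vt : valid (s1, strands4 w t false false false).
  exact: (valid_strand_label (vertical_vertical_state pre_pos)).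
have ht : [&& valid (s1, strands4 w t false false false),
    hdeg (s1, strands4 w t false false false) == 0 &
    qdeg (s1, strands4 w t false false false) == j].
  rewrite vt hdegE weight_vertical_state qdeg_strands //= /t.
  by case: jj => ->; case: eqP; lia.
have := congr1 (fun f : chain Dw 0 j => f (Sub (s1, strands4 w t false false false) ht)) z0.
rewrite ffun_intmulE ZE ffunE SubK /Z /= vertical_stateE eqxx strand_cocycleE.
by case: (t); rewrite /= mulr1.
Qed.

End LowDegrees.

(** The prefix consists of [2n] blocks of four letters; the remaining block belongs to the tail. *)
Lemma beta_cat n : exists2 pre, beta n = pre ++ beta_tail & all snd pre /\ size pre = (8 * n)%N.
Proof.
exists (braid_exp (2 * n) [:: sigma2; sigma1; sigma3; sigma2]).
  by rewrite /beta /braid_exp nseqD flatten_cat -catA.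
rewrite /braid_exp; elim: n => [|n [IH1 IH2]]; first by rewrite muln0.
rewrite mulnS [(2 + _)%N]/= ; split=> /=; first by [].
by rewrite IH2; lia.
Qed.

Theorem theorem5p13 (n : nat) (hn : (1 <= n)%N) (i j : int) :
  let special := i = 0 /\ (j = 4 + 8 * n%:Z + 1 \/ j = 4 + 8 * n%:Z - 1) in
  (special -> zmod_iso (Kh (K n) i j) int) /\
  (i <= 1 -> ~ special -> forall x : Kh (K n) i j, x = 0).
Proof.
move=> special; rewrite /K; have [pre -> [pos sz]] := beta_cat n.
split=> [[-> hj]|i1 ns].
  (* The degree [8n + 5] carries the alternating sum and [8n + 3] carries v_-^{(x) 4}. *)
  by apply: Kh0_iso => //; rewrite sz; case: hj => ->; [right | left]; lia.
have [iE|i0] := eqVneq i 0.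
  move: ns; rewrite /special iE => ns.
  by apply: Kh0_eq0 => // jE; apply: ns; split=> //; rewrite jE sz; [right | left]; lia.
have [iE|i1'] := eqVneq i 1.
  by apply: (@Kh_exact _ pos 2); [rewrite iE | exact: exact_plus1].
have [iE|im1] := eqVneq i (- 1).
  by apply: (@Kh_exact _ pos 0); [rewrite iE | exact: exact_minus1].
by apply: Kh_below => //; lia.
Qed.
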